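(* (Butterfly theorem) Let $G,N,G',N',b,b',A=b\mathcal{O}G,A'=b'\mathcal{O}G'$ be as in the context. Let $\hat G$ be another finite group having $N$ as a normal subgroup, such that the block idempotent $b$ is also $\hat G$-invariant. Let $\mathcal{C}=\mathcal{O}C_G(N)$. Assume that: (1) $C_G(N)\subseteq G'$; (2) $\tilde M$ induces a $\bar G$-graded Morita equivalence over $\mathcal{C}$ between $A$ and $A'$; (3) the conjugation maps $\varepsilon:G\to\mathrm{Aut}(N)$ and $\hat\varepsilon:\hat G\to\mathrm{Aut}(N)$ satisfy $\varepsilon(G)=\hat\varepsilon(\hat G)$. Denote $\hat G'=\hat\varepsilon^{-1}(\varepsilon(G'))$. Then there is a $\hat G/N$-graded Morita equivalence over $\hat{\mathcal{C}}:=\mathcal{O}C_{\hat G}(N)$ between $\hat A:=b\mathcal{O}\hat G$ and $\hat A':=b'\mathcal{O}\hat G'$.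
   Context: $(\mathcal{K},\mathcal{O},k)$ is a $p$-modular system: $\mathcal{O}$ is a complete discrete valuation ring with field of fractions $\mathcal{K}$ and algebraically closed residue field $k$ of characteristic $p$; $\mathcal{K}$ contains all roots of unity of order $|G|$. $G$ is a finite group, $N\trianglelefteq G$, $G'\le G$ with $G=G'N$, $N'=G'\cap N$, so $\bar G:=G/N\simeq G'/N'$. $b\in Z(\mathcal{O}N)$ and $b'\in Z(\mathcal{O}N')$ are $\bar G$-invariant block idempotents (fixed under conjugation by $G$, respectively $G'$). $A=b\mathcal{O}G$ and $A'=b'\mathcal{O}G'$ are $\bar G$-graded algebras with $A_{\bar g}=b\mathcal{O}[gN]$, $A'_{\bar g}=b'\mathcal{O}[gN']$ ($g\in G'$), with identity components $B=b\mathcal{O}N$, $B'=b'\mathcal{O}N'$. When $C_G(N)\subseteq G'$, the group algebra $\mathcal{C}=\mathcal{O}C_G(N)$ is $\bar G$-graded ($\mathcal{C}_{\bar g}$ is spanned by $C_G(N)\cap gN$), $\bar G$ acts on it by conjugation (${}^{\bar g}c=gcg^{-1}$), and it maps to $C_A(B)$ and $C_{A'}(B')$ by $c\mapsto bc$, $c\mapsto b'c$. A $\bar G$-graded $(A,A')$-bimodule over $\mathcal{C}$ is an $(A,A')$-bimodule $\tilde M=\bigoplus_{\bar g}\tilde M_{\bar g}$ with $A_{\bar g}\tilde M_{\bar x}A'_{\bar h}\subseteq\tilde M_{\bar g\bar x\bar h}$ and $\tilde m_{\bar g}\,c={}^{\bar g}c\,\tilde m_{\bar g}$ for all $c\in\mathcal{C}$,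 $\bar g\in\bar G$, $\tilde m_{\bar g}\in\tilde M_{\bar g}$. Its $A$-dual $\tilde M^*=\mathrm{Hom}_A(\tilde M,A)$ is a $\bar G$-graded $(A',A)$-bimodule over $\mathcal{C}$ via $(a'fa)(m)=f(ma')a$, with $\bar x$-component $\{f\mid f(\tilde M_{\bar g})\subseteq A_{\bar g\bar x}\ \forall\bar g\}$. A $\bar G$-graded $(A,A')$-bimodule $\tilde M$ over $\mathcal{C}$ induces a $\bar G$-graded Morita equivalence over $\mathcal{C}$ between $A$ and $A'$ if $\tilde M\otimes_{A'}\tilde M^*\cong A$ and $\tilde M^*\otimes_A\tilde M\cong A'$ as $\bar G$-graded bimodules over $\mathcal{C}$. The same notions apply to $\hat A$ and $\hat A'$ over $\hat{\mathcal{C}}=\mathcal{O}C_{\hat G}(N)$, using that under the hypotheses $\hat G'\le\hat G$, $C_{\hat G}(N)\le\hat G'$, $\hat G=N\hat G'$ and $N'=N\cap\hat G'$, so that $\hat A'$ is graded by $\hat G/N\simeq\hat G'/N'$. *)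

(* Defs.v *)
From HB Require Import structures.
From mathcomp Require Import all_boot all_order all_algebra all_fingroup.
From mathcomp Require Import generic_quotient ring_quotient fraction.
From mathcomp Require Import boolp functions.
From mathcomp Require freeg.

Set Implicit Arguments.
Unset Strict Implicit.
Unset Printing Implicit Defensive.

Import GRing.Theory.
Local Open Scope ring_scope.
Local Open Scope quotient_scope.

Section ModularSystem.
Variable O : idomainType.
Local Notation K := {fraction O}.

(* [v] is only meaningful on nonzero elements. *)
Definition is_discrete_valuation (F : fieldType) (v : F -> int) : Prop :=
  [/\ forall x y, x != 0 -> y != 0 -> v (x * y) = v x + v y,
      forall x y, x != 0 -> y != 0 -> x + y != 0 ->
        (Num.min (v x) (v y) <= v (x + y))
    & exists2 x, x != 0 & v x = 1].

(* The case x = y stands for v (x - y) = +oo. *)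
Definition val_close (v : K -> int) (e : int) (x y : O) : Prop :=
  x = y \/ e <= v (tofrac (x - y)).

Definition is_complete_dvr : Prop :=
  exists v : K -> int,
    [/\ is_discrete_valuation v,
        forall x : K, x != 0 -> (exists a : O, x = tofrac a) <-> 0 <= v x
      & forall u : nat -> O,
          (forall e, exists n0, forall m n,
             (n0 <= m)%N -> (n0 <= n)%N -> val_close v e (u m) (u n)) ->
          exists l : O, forall e, exists n0, forall n,
             (n0 <= n)%N -> val_close v e (u n) l].

Definition is_residue_field (k : fieldType) (red : {rmorphism O -> k}) : Prop :=
  (forall y, exists x, red x = y) /\
  (forall x, red x = 0 <-> x \isn't a GRing.unit).

Definition has_roots_of_unity (F : fieldType) (n : nat) : Prop :=
  exists rs : seq F, 'X^n - 1 = \prod_(z <- rs) ('X - z%:P).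

End ModularSystem.

Section GroupAlgebra.
Variables (R : comNzRingType) (gT : finGroupType).

(* An alias is needed: {ffun gT -> R} carries the pointwise product. *)
Definition galg : Type := {ffun gT -> R}.
HB.instance Definition _ := GRing.Lmodule.copy galg {ffun gT -> R^o}.

Implicit Types (a b c e : galg) (g h : gT).

Definition gcoef (a : galg) (g : gT) : R := (a : {ffun gT -> R}) g.

Definition gbase g : galg := [ffun h => (h == g)%:R].
Definition gmul a b : galg := [ffun g => \sum_h gcoef a h * gcoef b (h^-1 * g)%g].

Lemma galgP a b : (forall g, gcoef a g = gcoef b g) <-> a = b.
Proof. by split=> [|->//] e; apply/ffunP. Qed.

Lemma gmulE a b g : gcoef (gmul a b) g = \sum_h gcoef a h * gcoef b (h^-1 * g)%g.
Proof. by rewrite /gcoef ffunE. Qed.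

Lemma gaddE a b g : gcoef (a + b) g = gcoef a g + gcoef b g.
Proof. by rewrite /gcoef ffunE. Qed.

Lemma goppE a g : gcoef (- a) g = - gcoef a g.
Proof. by rewrite /gcoef ffunE. Qed.

Lemma gzeroE g : gcoef 0 g = 0.
Proof. by rewrite /gcoef ffunE. Qed.

Lemma gbaseE g h : gcoef (gbase g) h = (h == g)%:R.
Proof. by rewrite /gcoef ffunE. Qed.

Fact gmulA : associative gmul.
Proof.
move=> a b c; apply/galgP => g; rewrite !gmulE.
under eq_bigr => h _ do rewrite gmulE mulr_sumr.
under [RHS]eq_bigr => h _ do rewrite gmulE mulr_suml.
rewrite [RHS]exchange_big; apply: eq_bigr => h _ /=.
rewrite (reindex_inj (mulgI h^-1%g)) /=; apply: eq_bigr => l _.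
by rewrite mulrA invMg invgK -!mulgA mulKVg.
Qed.

Fact gmul1 : left_id (gbase 1%g) gmul.
Proof.
move=> a; apply/galgP => g; rewrite gmulE (bigD1 1%g) //= gbaseE eqxx mul1r.
by rewrite invg1 mul1g big1 ?addr0 // => h /negPf h1; rewrite gbaseE h1 mul0r.
Qed.

Fact gmulr1 : right_id (gbase 1%g) gmul.
Proof.
move=> a; apply/galgP => g; rewrite gmulE (bigD1 g) //= gbaseE mulVg eqxx mulr1.
rewrite big1 ?addr0 // => h /negPf h1.
by rewrite gbaseE -eq_mulVg1 h1 mulr0.
Qed.

Fact gmulDl : left_distributive gmul +%R.
Proof.
move=> a b c; apply/galgP => g; rewrite gaddE !gmulE -big_split /=.
by apply: eq_bigr => h _; rewrite gaddE mulrDl.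
Qed.

Fact gmulDr : right_distributive gmul +%R.
Proof.
move=> a b c; apply/galgP => g; rewrite gaddE !gmulE -big_split /=.
by apply: eq_bigr => h _; rewrite gaddE mulrDr.
Qed.

Fact gone_neq0 : gbase 1%g != 0 :> galg.
Proof.
by apply/eqP=> /galgP/(_ 1%g)/eqP; rewrite gbaseE gzeroE eqxx oner_eq0.
Qed.

HB.instance Definition _ := GRing.Zmodule_isNzRing.Build galg
  gmulA gmul1 gmulr1 gmulDl gmulDr gone_neq0.

(* The group algebra RX of a subgroup X, and more generally the R-span of a   *)
(* subset X, inside the group algebra of the ambient finite group.            *)
Definition gspan (X : {set gT}) (a : galg) : bool :=
  [forall g, (gcoef a g != 0) ==> (g \in X)].

Lemma gspanP (X : {set gT}) a :
  reflect (forall g, g \notin X -> gcoef a g = 0) (gspan X a).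
Proof.
apply: (iffP forallP) => aX g; first by move=> /negPf gX; apply/eqP;
  move: (aX g); rewrite gX implybF negbK.
by apply/implyP; apply: contraNT => /aX ->.
Qed.

Definition gconj g a : galg := gbase g * a * gbase g^-1%g.

Definition ginvariant (G : {set gT}) a : Prop :=
  forall g, g \in G -> gconj g a = a.

Definition central_idempotent (N : {set gT}) e : Prop :=
  [/\ gspan N e, e * e = e & forall a, gspan N a -> a * e = e * a].

(* Block idempotents of RN are the primitive idempotents of Z(RN). *)
Definition block_idempotent (N : {set gT}) b : Prop :=
  [/\ central_idempotent N b, b != 0
    & forall e f, central_idempotent N e -> central_idempotent N f ->
        e * f = 0 -> b = e + f -> e = 0 \/ f = 0].

Lemma gspan0 (X : {set gT}) : gspan X 0.
Proof. by apply/gspanP => g _; rewrite gzeroE. Qed.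

Lemma gspanB (X : {set gT}) a b : gspan X a -> gspan X b -> gspan X (a - b).
Proof.
move=> /gspanP aX /gspanP bX; apply/gspanP => g gX.
by rewrite gaddE goppE aX // bX // subr0.
Qed.

Lemma gspanM (G : {group gT}) a b : gspan G a -> gspan G b -> gspan G (a * b).
Proof.
move=> /gspanP aX /gspanP bX; apply/gspanP => g gX.
rewrite [LHS]gmulE big1 // => h _; have [hG|hG] := boolP (h \in G).
  by rewrite bX ?mulr0 // groupMl ?groupV.
by rewrite aX ?mul0r.
Qed.

(* The algebra bRG, for b an idempotent of RG commuting with RG. Its elements *)
(* are those a in RG with b a = a = a b, and its unit is b. To get a ring     *)
(* without carrying proofs, b is replaced by 0 when it is not an idempotent   *)
(* of RG (see balg_unitE).                                                    *)
Section BlockAlgebra.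
Variables (G : {group gT}) (b : galg).

Definition balg_unit : galg :=
  if gspan G b && (b * b == b) then b else 0.

Lemma balg_unitE : gspan G b -> b * b = b -> balg_unit = b.
Proof. by rewrite /balg_unit => -> ->; rewrite eqxx. Qed.

Definition in_balg : pred galg := fun a =>
  [&& gspan G a, balg_unit * a == a & a * balg_unit == a].

Record balg : Type := Balg { balg_val :> galg; _ : in_balg balg_val }.

HB.instance Definition _ := [isSub for balg_val].
HB.instance Definition _ := [Choice of balg by <:].

Fact in_balg_zmod : zmod_closed in_balg.
Proof.
split=> [|x y]; rewrite !unfold_in /in_balg.
  by rewrite gspan0 mulr0 mul0r eqxx.
move=> /and3P[xG /eqP ex /eqP xe] /and3P[yG /eqP ey /eqP ye].
by rewrite gspanB // mulrBr mulrBl ex xe ey ye !eqxx.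
Qed.
HB.instance Definition _ := GRing.isZmodClosed.Build galg in_balg in_balg_zmod.
HB.instance Definition _ := [SubChoice_isSubZmodule of balg by <:].

Fact in_balg1 : in_balg balg_unit.
Proof.
rewrite /in_balg /balg_unit; case: ifP => [/andP[-> /eqP->]|_].
  by rewrite eqxx.
by rewrite gspan0 mulr0 eqxx.
Qed.

Fact in_balgM x y : in_balg x -> in_balg y -> in_balg (x * y).
Proof.
move=> /and3P[xG /eqP ex _] /and3P[yG _ /eqP ye].
by rewrite /in_balg gspanM // mulrA ex -mulrA ye !eqxx.
Qed.

Definition balg1 := Balg in_balg1.
Definition balg_mul (x y : balg) := Balg (in_balgM (valP x) (valP y)).

Fact balg_mulA : associative balg_mul.
Proof. by move=> x y z; apply: val_inj; rewrite /= mulrA. Qed.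
Fact balg_mul1 : left_id balg1 balg_mul.
Proof. by move=> x; apply: val_inj; case: x => x /= /and3P[_ /eqP]. Qed.
Fact balg_mulr1 : right_id balg1 balg_mul.
Proof. by move=> x; apply: val_inj; case: x => x /= /and3P[_ _ /eqP]. Qed.
Fact balg_mulDl : left_distributive balg_mul +%R.
Proof. by move=> x y z; apply: val_inj; rewrite /= mulrDl. Qed.
Fact balg_mulDr : right_distributive balg_mul +%R.
Proof. by move=> x y z; apply: val_inj; rewrite /= mulrDr. Qed.

HB.instance Definition _ := GRing.Zmodule_isPzRing.Build balg
  balg_mulA balg_mul1 balg_mulr1 balg_mulDl balg_mulDr.

(* The image b c of c in bRG (0 if b c does not belong to bRG). *)
Definition balg_of (c : galg) : balg := insubd 0 (b * c).

End BlockAlgebra.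
End GroupAlgebra.

(* The linear extension RX -> R[hT] of f : X -> hT; coefficients of a outside *)
(* X are discarded.                                                           *)
Definition gpush (R : comNzRingType) (gT hT : finGroupType) (X : {set gT})
    (f : gT -> hT) (a : galg R gT) : galg R hT :=
  \sum_(g in X) gcoef a g *: gbase R (f g).

Definition is_subgroup (V : zmodType) (S : V -> Prop) : Prop :=
  S 0 /\ forall x y, S x -> S y -> S (x - y).

Definition gen_subgroup (V : zmodType) (P : V -> Prop) (x : V) : Prop :=
  forall S : V -> Prop, is_subgroup S -> (forall z, P z -> S z) -> S x.

(* V is the direct sum of the additive subgroups V_q, q in Q. *)
Definition is_direct_sum (Q : finType) (V : zmodType) (V_ : Q -> V -> Prop) :
    Prop :=
  [/\ forall q, is_subgroup (V_ q),
      forall v, exists2 f : Q -> V, forall q, V_ q (f q) & v = \sum_q f q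
    & forall f : Q -> V, (forall q, V_ q (f q)) -> \sum_q f q = 0 ->
        forall q, f q = 0].

Section GradedBimodules.
Variable Q : finGroupType.

(* A ring with a family of subsets A_q, meant to be a Q-grading; that it is   *)
(* one is not part of the structure.                                          *)
Record gring : Type := GRingFam {
  gring_sort :> pzRingType;
  gring_comp : Q -> gring_sort -> Prop
}.

Definition is_bimodule (A A' : pzRingType) (M : zmodType)
    (la : A -> M -> M) (ra : M -> A' -> M) : Prop :=
  [/\ [/\ forall a m1 m2, la a (m1 + m2) = la a m1 + la a m2,
          forall a1 a2 m, la (a1 + a2) m = la a1 m + la a2 m,
          forall a1 a2 m, la (a1 * a2) m = la a1 (la a2 m)
        & forall m, la 1 m = m],
      [/\ forall m1 m2 a, ra (m1 + m2) a = ra m1 a + ra m2 a,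
          forall m a1 a2, ra m (a1 + a2) = ra m a1 + ra m a2,
          forall m a1 a2, ra m (a1 * a2) = ra (ra m a1) a2
        & forall m, ra m 1 = m]
    & forall a m a', ra (la a m) a' = la a (ra m a')].

(* An (A, A')-bimodule M with a family of subsets M_q, q in Q; the family is  *)
(* required to be a grading by [graded_bimodule] below.                       *)
Record gbimod (A A' : gring) : Type := GBimod {
  gbimod_sort :> zmodType;
  lact : A -> gbimod_sort -> gbimod_sort;
  ract : gbimod_sort -> A' -> gbimod_sort;
  gcomp : Q -> gbimod_sort -> Prop;
  gbimodP : is_bimodule lact ract
}.

Section BimodTheory.
Variables (A A' : gring) (M : gbimod A A').
Implicit Types (a : A) (m : M).

Lemma lactDr a m1 m2 : lact a (m1 + m2) = lact a m1 + lact a m2.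
Proof. by have [[+ _ _ _] _ _] := gbimodP M. Qed.
Lemma lactDl a1 a2 m : lact (a1 + a2) m = lact a1 m + lact a2 m.
Proof. by have [[_ + _ _] _ _] := gbimodP M. Qed.
Lemma lactA a1 a2 m : lact (a1 * a2) m = lact a1 (lact a2 m).
Proof. by have [[_ _ + _] _ _] := gbimodP M. Qed.
Lemma lact1 m : lact 1 m = m.
Proof. by have [[_ _ _ +] _ _] := gbimodP M. Qed.
Lemma ractDl m1 m2 (a' : A') : ract (m1 + m2) a' = ract m1 a' + ract m2 a'.
Proof. by have [_ [+ _ _ _] _] := gbimodP M. Qed.
Lemma ractDr m (a1 a2 : A') : ract m (a1 + a2) = ract m a1 + ract m a2.
Proof. by have [_ [_ + _ _] _] := gbimodP M. Qed.
Lemma ractA m (a1 a2 : A') : ract m (a1 * a2) = ract (ract m a1) a2.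
Proof. by have [_ [_ _ + _] _] := gbimodP M. Qed.
Lemma ract1 m : ract m 1 = m.
Proof. by have [_ [_ _ _ +] _] := gbimodP M. Qed.
Lemma lractA a m (a' : A') : ract (lact a m) a' = lact a (ract m a').
Proof. by have [_ _ +] := gbimodP M. Qed.

Definition graded_bimodule : Prop :=
  is_direct_sum (@gcomp _ _ M) /\
  forall g x h (a : A) (m : M) (a' : A'),
    gring_comp g a -> gcomp x m -> gring_comp h a' ->
      gcomp (g * x * h)%g (ract (lact a m) a').

End BimodTheory.

Definition gbimod_iso (A A' : gring) (M N : gbimod A A') : Prop :=
  exists f : {additive M -> N},
    [/\ bijective f,
        forall (a : A) m, f (lact a m) = lact a (f m),
        forall m (a' : A'), f (ract m a') = ract (f m) a'
      & forall q m, gcomp q m <-> gcomp q (f m)].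

Fact greg_subproof (A : gring) :
  is_bimodule (fun a m : A => a * m) (fun m a : A => m * a).
Proof.
by split=> [||*]; [split=> *|split=> *|];
  rewrite ?(mulrDl, mulrDr, mul1r, mulr1) ?mulrA.
Qed.

Definition greg (A : gring) : gbimod A A :=
  @GBimod A A A _ _ (@gring_comp A) (greg_subproof A).

Section Dual.
Variables (A A' : gring) (M : gbimod A A').

Definition left_linear (f : M -> A) : Prop :=
  (forall m1 m2, f (m1 + m2) = f m1 + f m2) /\
  (forall a m, f (lact a m) = a * f m).

Definition in_dual : pred (M -> A) := fun f => `[< left_linear f >].

Record mdual : Type := Dual { dual_fun :> M -> A; _ : in_dual dual_fun }.

HB.instance Definition _ := [isSub for dual_fun].
HB.instance Definition _ := [Choice of mdual by <:].

Fact in_dual_zmod : zmod_closed in_dual.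
Proof.
split=> [|f f']; rewrite !unfold_in /in_dual.
  by apply/asboolP; split=> [m1 m2|a m]; rewrite ?[RHS]addr0 ?[RHS]mulr0.
move=> /asboolP[fD fZ] /asboolP[gD gZ].
have fgE m : (f - f') m = f m - f' m by [].
by apply/asboolP; split=> [m1 m2|a m]; rewrite !fgE ?fD ?gD ?fZ ?gZ
  ?opprD ?mulrBr // addrACA.
Qed.
HB.instance Definition _ :=
  GRing.isZmodClosed.Build (M -> A) in_dual in_dual_zmod.
HB.instance Definition _ := [SubChoice_isSubZmodule of mdual by <:].

Lemma dualP (f : mdual) : left_linear f.
Proof. by case: f => f /= /asboolP. Qed.

Lemma dual_ext (f f' : mdual) : (forall m, f m = f' m) -> f = f'.
Proof. by move=> e; apply: val_inj; apply/funext. Qed.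

Fact dual_lact_subproof (a' : A') (f : mdual) :
  in_dual (fun m => f (ract m a')).
Proof.
have [fD fZ] := dualP f; apply/asboolP; split=> [m1 m2|a m].
  by rewrite ractDl fD.
by rewrite lractA fZ.
Qed.
Definition dual_lact a' f : mdual := Dual (dual_lact_subproof a' f).

Fact dual_ract_subproof (f : mdual) (a : A) : in_dual (fun m => f m * a).
Proof.
have [fD fZ] := dualP f; apply/asboolP; split=> [m1 m2|a1 m].
  by rewrite fD mulrDl.
by rewrite fZ mulrA.
Qed.
Definition dual_ract f a : mdual := Dual (dual_ract_subproof f a).

Fact dual_subproof : is_bimodule dual_lact dual_ract.
Proof.
split; [split|split|].
- by move=> a f1 f2; apply: dual_ext.
- move=> a1 a2 f; apply: dual_ext => m /=.
  by rewrite ractDr; have [-> _] := dualP f.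
- by move=> a1 a2 f; apply: dual_ext => m /=; rewrite ractA.
- by move=> f; apply: dual_ext => m /=; rewrite ract1.
- by move=> f1 f2 a; apply: dual_ext => m /=; apply: mulrDl.
- by move=> f a1 a2; apply: dual_ext => m /=; apply: mulrDr.
- by move=> f a1 a2; apply: dual_ext => m /=; rewrite mulrA.
- by move=> f; apply: dual_ext => m /=; rewrite mulr1.
- by move=> a' f a; apply: dual_ext.
Qed.

Definition dual_comp (x : Q) (f : mdual) : Prop :=
  forall g m, gcomp g m -> gring_comp (g * x)%g (f m).

Definition gdual : gbimod A' A :=
  @GBimod A' A mdual _ _ dual_comp dual_subproof.

End Dual.

(* The tensor product: the quotient of the free abelian group on M * N by the *)
(* subgroup generated by the bilinearity and balancing relations              *)
Section Tensor.
Variables (A B D : gring) (M : gbimod A B) (N : gbimod B D).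
Import freeg.

Definition free_tensor : zmodType := {freeg (M * N)%type}.
Definition free_pure (m : M) (n : N) : free_tensor := << (m, n) >>.

Variant tensor_rel : free_tensor -> Prop :=
| TensorDl m1 m2 n :
    tensor_rel (free_pure (m1 + m2) n - free_pure m1 n - free_pure m2 n)
| TensorDr m n1 n2 :
    tensor_rel (free_pure m (n1 + n2) - free_pure m n1 - free_pure m n2)
| TensorA m b n :
    tensor_rel (free_pure (ract m b) n - free_pure m (lact b n)).

Definition tensor_null : pred free_tensor :=
  fun z => `[< gen_subgroup tensor_rel z >].

Fact tensor_null_zmod : zmod_closed tensor_null.
Proof.
split=> [|x y]; rewrite !unfold_in /tensor_null.
  by apply/asboolP => S [S0 _] _.
move=> /asboolP Sx /asboolP Sy; apply/asboolP => S hS hP.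
by apply: hS.2; [apply: Sx|apply: Sy].
Qed.
HB.instance Definition _ :=
  GRing.isZmodClosed.Build free_tensor tensor_null tensor_null_zmod.

Definition tensor : Type :=
  Quotient.quot (GRing.ZmodClosed.clone _ tensor_null _).
HB.instance Definition _ := GRing.Zmodule.on tensor.

Definition tensor_pi : free_tensor -> tensor := \pi.
Definition tpure (m : M) (n : N) : tensor := tensor_pi (free_pure m n).

Fact tensor_pi_zmod : zmod_morphism tensor_pi.
Proof. exact: (raddfB \pi_tensor). Qed.
HB.instance Definition _ :=
  GRing.isZmodMorphism.Build free_tensor tensor tensor_pi tensor_pi_zmod.

Fact tensor_pi_eq x y : (tensor_pi x == tensor_pi y) = tensor_null (x - y).
Proof. by rewrite /tensor_pi piE. Qed.

Lemma tensor_gen (S : tensor -> Prop) :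
  is_subgroup S -> (forall m n, S (tpure m n)) -> forall t, S t.
Proof.
move=> [S0 SB] Sp; elim/quotW => z; rewrite -[\pi z]/(tensor_pi z).
have SN t : S t -> S (- t) by move=> St; rewrite -sub0r; apply: SB.
have SD t t' : S t -> S t' -> S (t + t').
  by move=> St St'; rewrite -[t']opprK; apply/SB/SN.
have SM t (c : int) : S t -> S (t *~ c).
  move=> St; have Sn n : S (t *+ n) by elim: n => // n; rewrite mulrS; apply: SD.
  by case: c => n; [exact: Sn|exact/SN/Sn].
rewrite -(freeg_sumE z) raddf_sum; apply: big_ind => // -[m n] _ /=.
rewrite -[coeff _ _]intz -freegU_mulz raddfMz; exact/SM/Sp.
Qed.

Lemma pureDl m1 m2 n : tpure (m1 + m2) n = tpure m1 n + tpure m2 n.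
Proof.
apply/eqP; rewrite -raddfD tensor_pi_eq opprD addrA.
by apply/asboolP => S _; apply; apply: TensorDl.
Qed.

Lemma pureDr m n1 n2 : tpure m (n1 + n2) = tpure m n1 + tpure m n2.
Proof.
apply/eqP; rewrite -raddfD tensor_pi_eq opprD addrA.
by apply/asboolP => S _; apply; apply: TensorDr.
Qed.

Lemma pureA m b n : tpure (ract m b) n = tpure m (lact b n).
Proof.
apply/eqP; rewrite tensor_pi_eq.
by apply/asboolP => S _; apply; apply: TensorA.
Qed.

Section Lift.
Variables (V : zmodType) (f : M -> N -> V).

Definition balanced : Prop :=
  [/\ forall m1 m2 n, f (m1 + m2) n = f m1 n + f m2 n,
      forall m n1 n2, f m (n1 + n2) = f m n1 + f m n2
    & forall m b n, f (ract m b) n = f m (lact b n)].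

Definition free_lift : free_tensor -> V :=
  fglift (fun p : M * N => f p.1 p.2 : zmodule V).

Fact free_lift_zmod : zmod_morphism free_lift.
Proof.
exact: (@lift_is_additive int _ (zmodule V) (fun p => f p.1 p.2)).
Qed.
HB.instance Definition _ :=
  GRing.isZmodMorphism.Build free_tensor V free_lift free_lift_zmod.

Definition tensor_lift (t : tensor) : V := free_lift (repr t).

Hypothesis fP : balanced.

Fact free_lift_null z : tensor_null z -> free_lift z = 0.
Proof.
have [fDl fDr fA] := fP.
move=> /asboolP/(_ (fun z => free_lift z = 0)); apply=> [|{}z].
  by split=> [|x y x0 y0]; rewrite ?raddf0 // raddfB /= x0 y0 subr0.
have fE m n : free_lift (free_pure m n) = f m n.
  by rewrite /free_lift liftU scale1r.
by case=> *; rewrite !raddfB /= !fE ?fDl ?fDr ?fA ?subrr // addrAC addrK subrr.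
Qed.

Lemma tensor_lift_pi z : tensor_lift (tensor_pi z) = free_lift z.
Proof.
apply/eqP; rewrite -subr_eq0 /tensor_lift -raddfB /=.
by rewrite free_lift_null // -tensor_pi_eq /tensor_pi reprK.
Qed.

Lemma tensor_lift_pure m n : tensor_lift (tpure m n) = f m n.
Proof. by rewrite tensor_lift_pi /free_lift liftU scale1r. Qed.

Lemma tensor_liftB t t' : tensor_lift (t - t') = tensor_lift t - tensor_lift t'.
Proof.
elim/quotW: t => z; elim/quotW: t' => z'.
rewrite -[\pi z]/(tensor_pi z) -[\pi z']/(tensor_pi z') -raddfB.
by rewrite !tensor_lift_pi raddfB.
Qed.

Lemma tensor_liftD t t' : tensor_lift (t + t') = tensor_lift t + tensor_lift t'.
Proof.
have l0 : tensor_lift 0 = 0 by have := tensor_liftB 0 0; rewrite !subrr.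
have lN : tensor_lift (- t') = - tensor_lift t'.
  by rewrite -[- t']sub0r tensor_liftB l0 sub0r.
by rewrite -{1}[t']opprK tensor_liftB lN opprK.
Qed.

End Lift.

Lemma eq_on_pure (V : zmodType) (h h' : tensor -> V) :
    (forall t t', h (t - t') = h t - h t') ->
    (forall t t', h' (t - t') = h' t - h' t') ->
  (forall m n, h (tpure m n) = h' (tpure m n)) -> forall t, h t = h' t.
Proof.
move=> hB hB' e; apply: tensor_gen => //; split=> [|x y ex ey].
  by have := hB 0 0; have := hB' 0 0; rewrite !subrr => -> ->.
by rewrite hB hB' ex ey.
Qed.

(* The actions are determined by a (m # n) d = (a m) # (n d). *)
Definition tensor_lact (a : A) : tensor -> tensor :=
  tensor_lift (fun m n => tpure (lact a m) n).
Definition tensor_ract (t : tensor) (d : D) : tensor :=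
  tensor_lift (fun m n => tpure m (ract n d)) t.

Fact tensor_lact_balanced a : balanced (fun m n => tpure (lact a m) n).
Proof.
by split=> [m1 m2 n|m n1 n2|m b n]; rewrite ?lactDr ?pureDl ?pureDr // -lractA pureA.
Qed.

Fact tensor_ract_balanced d : balanced (fun m n => tpure m (ract n d)).
Proof.
by split=> [m1 m2 n|m n1 n2|m b n]; rewrite ?ractDl ?pureDl ?pureDr // lractA pureA.
Qed.

Lemma tensor_lactE a m n : tensor_lact a (tpure m n) = tpure (lact a m) n.
Proof. exact/tensor_lift_pure/tensor_lact_balanced. Qed.

Lemma tensor_ractE m n d : tensor_ract (tpure m n) d = tpure m (ract n d).
Proof. exact/(tensor_lift_pure (tensor_ract_balanced d)). Qed.

Fact tensor_subproof : is_bimodule tensor_lact tensor_ract.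
Proof.
have lB a := tensor_liftB (tensor_lact_balanced a).
have rB d := tensor_liftB (tensor_ract_balanced d).
have addBB (t t' u u' : tensor) : (t - t') + (u - u') = (t + u) - (t' + u').
  by rewrite opprD addrACA.
split; [split|split|].
- by move=> a; apply/tensor_liftD/tensor_lact_balanced.
- move=> a1 a2; apply: eq_on_pure => [||m n]; [exact: lB| |].
    by move=> t t'; rewrite /tensor_lact !lB addBB.
  by rewrite !tensor_lactE lactDl pureDl.
- move=> a1 a2; apply: eq_on_pure => [||m n]; [exact: lB| |].
    by move=> t t'; rewrite /tensor_lact !lB.
  by rewrite !tensor_lactE lactA.
- by apply: eq_on_pure => [||m n] //; rewrite ?tensor_lactE ?lact1 //; apply: lB.
- by move=> t t' d; apply/(tensor_liftD (tensor_ract_balanced d)).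
- move=> t d1 d2; move: t; apply: eq_on_pure => [||m n]; [exact: rB| |].
    by move=> t t'; rewrite /tensor_ract !rB addBB.
  by rewrite !tensor_ractE ractDr pureDr.
- move=> t d1 d2; move: t; apply: eq_on_pure => [||m n]; [exact: rB| |].
    by move=> t t'; rewrite /tensor_ract !rB.
  by rewrite !tensor_ractE ractA.
- by apply: eq_on_pure => [||m n] //; rewrite ?tensor_ractE ?ract1 //; apply: rB.
- move=> a t d; move: t; apply: eq_on_pure => [||m n].
  + by move=> t t'; rewrite /tensor_lact /tensor_ract lB rB.
  + by move=> t t'; rewrite /tensor_lact /tensor_ract rB lB.
  by rewrite tensor_lactE !tensor_ractE tensor_lactE.
Qed.

(* The x-component is generated by the tensors m # n with m in M_g, n in N_h  *)
(* and g h = x.                                                               *)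
Variant tensor_hom (x : Q) : tensor -> Prop :=
| TensorHom g h m n :
    (g * h)%g = x -> gcomp g m -> gcomp h n -> tensor_hom x (tpure m n).

Definition gtensor : gbimod A D :=
  @GBimod A D tensor _ _ (fun x => gen_subgroup (tensor_hom x)) tensor_subproof.

End Tensor.

End GradedBimodules.

Section BlockExtensions.
Variables (R : comNzRingType) (gT : finGroupType) (G N : {group gT}).

(* The grading group is G / N. For a subgroup H of G with G = H N and an      *)
(* idempotent b of RH, the component of bRH at the coset x of N is bR[x :&: H]*)
(* where x :&: H is a coset of H :&: N; elements of bRH have support in H.    *)
Definition gbalg (H : {group gT}) (b : galg R gT) :
    gring (subg_of (G / N)) :=
  @GRingFam _ (balg H b)
    (fun x a => gspan (set_of_coset (sgval x)) (balg_val a)).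

Variables (H : {group gT}) (b b' : galg R gT).
Local Notation A := (gbalg G b).
Local Notation A' := (gbalg H b').

(* m c = (g c g^-1) m for m in the component of the coset of g and c in       *)
(* RC_G(N), acting through c |-> b c and c |-> b' c. For c in R1 this says    *)
(* that both actions of R on M coincide.                                      *)
Definition bimodule_over_centralizer (M : gbimod A A') : Prop :=
  forall (x : subg_of (G / N)) g (m : M) (c : galg R gT),
    g \in set_of_coset (sgval x) -> gcomp x m -> gspan 'C_G(N)%g c ->
    ract m (balg_of H b' c : A') = lact (balg_of G b (gconj g c) : A) m.

Definition induces_graded_morita (M : gbimod A A') : Prop :=
  [/\ graded_bimodule M, bimodule_over_centralizer M,
      gbimod_iso (gtensor M (gdual M)) (greg A)
    & gbimod_iso (gtensor (gdual M) M) (greg A')].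

End BlockExtensions.

(* Main.v *)
(* A graded bimodule M is determined by its component M_1, on which the pairs  *)
(* (g, h) in G x G' with gN = hN act by m |-> g m h^-1. Being over C means     *)
(* that the pairs (c, c) with c in C_G(N) act trivially, so that the action    *)
(* depends only on the automorphisms of N induced by g and h; it is thus       *)
(* also an action of the corresponding pairs of elements of Gh and Gh', and    *)
(* determines a graded bimodule Mh over the two new algebras. To avoid choices *)
(* of coset representatives, Mh is realised as a space of functions on the     *)
(* group Gamma of the pairs in G x Gh acting in the same way on N.             *)
(* The Morita property is transported through its characterisation by          *)
(* elements: M is a generator, has a dual basis, and A' = End_A(M)^op. As the  *)
(* algebras are crossed products, generation and the dual basis are witnessed  *)
(* in degree 1, where M and Mh agree.                                          *)

Require Import Defs.
From HB Require Import structures.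
From mathcomp Require Import all_boot all_order all_algebra all_fingroup.
From mathcomp Require Import fraction boolp.

Set Implicit Arguments.
Unset Strict Implicit.
Unset Printing Implicit Defensive.

Import GRing.Theory.
Local Open Scope ring_scope.

Local Notation ract := Defs.ract.

(** * Direct sums, bimodules and tensor products *)

(** Let Gamma be the [pullback]: the pairs (g, y) in G x Gh inducing the same automorphism of N.
    Equality of the images of G and Gh in Aut(N) makes the projection Gamma -> Gh surjective. Its
    kernel consists of the pairs (c, 1) with c in C_G(N) ([pullback_fiber]), and N embeds in Gamma
    diagonally. As C_G(N) lies in G', a pair has g in G' exactly when y is in Gh'. A pair acts on M
    through its first coordinate. Since m c = (g c g^-1) m for m in M_g, the ambiguity by C_G(N)
    cancels once elements of the new bimodule are taken to be equivariant functions Gamma -> M (the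
    type [hat]), and only y matters ([lmon_indep], [rmon_indep]). This gives a graded bimodule over
    the two new algebras. It is over the new centralizer because (1, y) is in Gamma when y
    centralizes N, so that y only translates the argument of a function ([hat_over_centralizer]).
    For the Morita property, isomorphisms of tensor products are traded for [morita_criterion], a
    statement about elements: [iso_morita_criterion] extracts it for M, and
    [criterion_graded_morita] recovers graded isomorphisms from it. All degrees of the algebras
    contain units, so generators and dual bases may be taken in degree 1 ([degree1_generation],
    [degree1_dual_basis]). Such data can be moved: elements by [exists_delta], linear forms by
    [exists_dual_hat], homogeneous elements of A' by [exists_lift]. By [hlact_dual_hat], the
    operators F |-> f(F) D of the new bimodule are computed value by value in M, which reduces
    [hat_morita_criterion] to the criterion for M. *)

Definition is_projection (Q : finType) (V : zmodType) (V_ : Q -> V -> Prop)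
    (pr : Q -> V -> V) : Prop :=
  [/\ forall q, {morph pr q : x y / x + y},
      forall q v, V_ q (pr q v),
      forall v, v = \sum_q pr q v
    & forall q r v, V_ r v -> pr q v = if q == r then v else 0].

Lemma direct_sum_proj (Q : finType) (V : zmodType) (V_ : Q -> V -> Prop) :
  is_direct_sum V_ -> exists pr, is_projection V_ pr.
Proof.
move=> [sgV exV unV].
have pick v : {f : Q -> V | (forall q, V_ q (f q)) /\ v = \sum_q f q}.
  by apply: cid; have [f fV ->] := exV v; exists f.
pose pr q v := sval (pick v) q.
have prV q v : V_ q (pr q v) by have [+ _] := svalP (pick v); apply.
have prS v : v = \sum_q pr q v by have [] := svalP (pick v).
have VB q x y : V_ q x -> V_ q y -> V_ q (x - y) by apply: (sgV q).2.
have V0 q : V_ q 0 by apply: (sgV q).1.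
have uniq_dec (f g : Q -> V) : (forall q, V_ q (f q)) -> (forall q, V_ q (g q)) ->
    \sum_q f q = \sum_q g q -> forall q, f q = g q.
  move=> fV gV e q; apply/eqP; rewrite -subr_eq0; apply/eqP.
  apply: (unV (fun q => f q - g q)) => [r|]; first exact: VB.
  by rewrite sumrB e subrr.
exists pr; split=> // [q x y|q r v vr].
  apply: (uniq_dec (pr^~ (x + y)) (fun q => pr q x + pr q y)) => // [r|].
    by rewrite -[pr r y]opprK -[- pr r y]sub0r; apply/VB/VB.
  by rewrite big_split /= -!prS.
apply: (uniq_dec (pr^~ v) (fun q => if q == r then v else 0)) => // [s|].
  by case: eqP => // ->.
by rewrite -prS -big_mkcond big_pred1_eq.
Qed.

Lemma bij_inj_surj (T U : Type) (f : T -> U) :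
  injective f -> (forall y, exists x, f x = y) -> bijective f.
Proof.
move=> finj fsurj; pose g y := sval (cid (fsurj y)).
have gK : cancel g f by move=> y; apply: svalP (cid (fsurj y)).
by exists g => // x; apply: finj; rewrite gK.
Qed.

Section Bimodules.
Variables (Q : finGroupType) (A A' : gring Q) (M : gbimod A A').

Lemma lactBr (a : A) (m1 m2 : M) : lact a (m1 - m2) = lact a m1 - lact a m2.
Proof. by apply: (addIr (lact a m2)); rewrite -lactDr !subrK. Qed.
Lemma lact0r (a : A) : lact a 0 = 0 :> M.
Proof. by rewrite -(subrr 0) lactBr !subrr. Qed.
Lemma lactBl (a1 a2 : A) (m : M) : lact (a1 - a2) m = lact a1 m - lact a2 m.
Proof. by apply: (addIr (lact a2 m)); rewrite -lactDl !subrK. Qed.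
Lemma lact0l (m : M) : lact (0 : A) m = 0.
Proof. by rewrite -(subrr (0 : A)) lactBl !subrr. Qed.
Lemma ractBl (a : A') (m1 m2 : M) : ract (m1 - m2) a = ract m1 a - ract m2 a.
Proof. by apply: (addIr (ract m2 a)); rewrite -ractDl !subrK. Qed.
Lemma ract0l (a : A') : ract 0 a = 0 :> M.
Proof. by rewrite -(subrr 0) ractBl !subrr. Qed.
Lemma ractBr (a1 a2 : A') (m : M) : ract m (a1 - a2) = ract m a1 - ract m a2.
Proof. by apply: (addIr (ract m a2)); rewrite -ractDr !subrK. Qed.
Lemma ract0r (m : M) : ract m (0 : A') = 0.
Proof. by rewrite -(subrr (0 : A')) ractBr !subrr. Qed.

Lemma lact_sumr (a : A) I (s : seq I) P (F : I -> M) :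
  lact a (\sum_(i <- s | P i) F i) = \sum_(i <- s | P i) lact a (F i).
Proof. exact: (big_morph _ (lactDr a) (lact0r a)). Qed.
Lemma lact_suml (m : M) I (s : seq I) P (F : I -> A) :
  lact (\sum_(i <- s | P i) F i) m = \sum_(i <- s | P i) lact (F i) m.
Proof. exact: (big_morph (fun a : A => lact a m) (fun a1 a2 => lactDl a1 a2 m) (lact0l m)). Qed.
Lemma ract_suml (a : A') I (s : seq I) P (F : I -> M) :
  ract (\sum_(i <- s | P i) F i) a = \sum_(i <- s | P i) ract (F i) a.
Proof. exact: (big_morph (fun x : M => ract x a) (fun x y => ractDl x y a) (ract0l a)). Qed.
Lemma ract_sumr (m : M) I (s : seq I) P (F : I -> A') :
  ract m (\sum_(i <- s | P i) F i) = \sum_(i <- s | P i) ract m (F i).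
Proof. exact: (big_morph (fun a : A' => ract m a) (ractDr m) (ract0r m)). Qed.

Lemma dualD (f : mdual M) m1 m2 : f (m1 + m2) = f m1 + f m2.
Proof. by have [+ _] := dualP f; apply. Qed.
Lemma dualZ (f : mdual M) (a : A) m : f (lact a m) = a * f m.
Proof. by have [_ +] := dualP f; apply. Qed.
Lemma dual0 (f : mdual M) : f 0 = 0.
Proof. by apply: (addIr (f 0)); rewrite -dualD !add0r. Qed.
Lemma dual_sum (f : mdual M) I (s : seq I) P (F : I -> M) :
  f (\sum_(i <- s | P i) F i) = \sum_(i <- s | P i) f (F i).
Proof. exact: (big_morph f (dualD f) (dual0 f)). Qed.

Lemma mdualDE (f g : mdual M) m : (f + g) m = f m + g m. Proof. by []. Qed.
Lemma mdual0E m : (0 : mdual M) m = 0. Proof. by []. Qed.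
Lemma mdual_sumE I (s : seq I) P (F : I -> mdual M) m :
  (\sum_(i <- s | P i) F i) m = \sum_(i <- s | P i) F i m.
Proof. exact: (big_morph (fun f : mdual M => f m) (fun f g => mdualDE f g m) (mdual0E m)). Qed.

Lemma mk_dual (f : M -> A) : left_linear f -> exists f' : mdual M, forall m, f' m = f m.
Proof. by move=> fP; exists (Dual (introT (asboolP _) fP : in_dual f)). Qed.

End Bimodules.

Section Tensors.
Variables (Q : finGroupType) (A B D : gring Q) (M : gbimod A B) (N : gbimod B D).

Lemma pure0r (m : M) : tpure m (0 : N) = 0.
Proof. by apply: (addIr (tpure m (0 : N))); rewrite -pureDr !add0r. Qed.
Lemma pure0l (n : N) : tpure (0 : M) n = 0.
Proof. by apply: (addIr (tpure (0 : M) n)); rewrite -pureDl !add0r. Qed.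
Lemma pureNl (m : M) (n : N) : tpure (- m) n = - tpure m n.
Proof. by apply: (addIr (tpure m n)); rewrite -pureDl !addNr pure0l. Qed.

Lemma pure_suml (n : N) I (s : seq I) P (F : I -> M) :
  tpure (\sum_(i <- s | P i) F i) n = \sum_(i <- s | P i) tpure (F i) n.
Proof. exact: (big_morph (fun m => tpure m n) (fun x y => pureDl x y n) (pure0l n)). Qed.
Lemma pure_sumr (m : M) I (s : seq I) P (F : I -> N) :
  tpure m (\sum_(i <- s | P i) F i) = \sum_(i <- s | P i) tpure m (F i).
Proof. exact: (big_morph (tpure m) (pureDr m) (pure0r m)). Qed.

Lemma tensor_sumP (t : tensor M N) :
  exists s : seq (M * N), t = \sum_(p <- s) tpure p.1 p.2.
Proof.
pose S (t : tensor M N) := exists s : seq (M * N), t = \sum_(p <- s) tpure p.1 p.2.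
apply: (@tensor_gen _ _ _ _ M N S) t => [|m n]; last by exists [:: (m, n)]; rewrite big_seq1.
split=> [|_ _ [s ->] [s' ->]]; first by exists [::]; rewrite big_nil.
exists (s ++ [seq (- p.1, p.2) | p <- s']); rewrite big_cat big_map /=; congr (_ + _).
by rewrite -sumrN; apply: eq_bigr => p _; rewrite pureNl.
Qed.

Section LiftSum.
Variables (V : zmodType) (f : M -> N -> V).
Hypothesis fP : balanced f.

Lemma tensor_lift0 : tensor_lift f 0 = 0.
Proof. by rewrite -(subrr (0 : tensor M N)) tensor_liftB ?subrr //. Qed.

Lemma tensor_lift_sum I (s : seq I) (F : I -> tensor M N) :
  tensor_lift f (\sum_(i <- s) F i) = \sum_(i <- s) tensor_lift f (F i).
Proof. exact: (big_morph (tensor_lift f) (tensor_liftD fP) tensor_lift0). Qed.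

Lemma tensor_lift_pures s :
  tensor_lift f (\sum_(p <- s) tpure p.1 p.2) = \sum_(p <- s) f p.1 p.2.
Proof. by rewrite tensor_lift_sum; apply: eq_bigr => p _; rewrite tensor_lift_pure. Qed.

End LiftSum.
End Tensors.

(** * Characterisation of graded Morita equivalences *)

Section Criterion.
Variables (Q : finGroupType) (A A' : gring Q) (M : gbimod A A').

(** M is a progenerator over A, by its trace ideal and a finite dual basis, and A' -> End_A(M),
    acting on the right, is bijective. *)
Definition morita_criterion : Prop :=
  [/\ exists s : seq (M * mdual M), \sum_(p <- s) p.2 p.1 = 1,
      exists s : seq (M * mdual M), forall m, m = \sum_(p <- s) lact (p.2 m) p.1,
      forall u : M -> M, (forall x y, u (x + y) = u x + u y) ->
        (forall a x, u (lact a x) = lact a (u x)) ->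
        exists a' : A', forall x, u x = ract x a'
    & forall a' : A', (forall x : M, ract x a' = 0) -> a' = 0].

Local Notation M' := (gdual M).

(* The isomorphisms need not be the evaluation maps, but f |-> phi (- # f)   *)
(* turns the first one into elements of the dual; theta below is the          *)
(* automorphism of M measuring the failure of associativity of phi and psi.   *)
Lemma iso_morita_criterion :
  gbimod_iso (gtensor M M') (greg A) -> gbimod_iso (gtensor M' M) (greg A') ->
  morita_criterion.
Proof.
move=> [phi [[phiV phiK phiVK] phiL phiR _]] [psi [[psiV psiK psiVK] psiL psiR _]].
have phi_lin (f : M') : exists f' : mdual M, forall m, f' m = phi (tpure m f).
  apply: mk_dual; split=> [m1 m2|a m]; first by rewrite pureDl raddfD.
  by rewrite -tensor_lactE; exact: (phiL a (tpure m f)).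
have [phid phidE] := choice phi_lin.
have [sphi sphiE] := tensor_sumP (phiV 1).
have [spsi spsiE] := tensor_sumP (psiV 1).
pose Phi (x : M) : tensor M' M -> M :=
  tensor_lift (fun (f : M') m => lact (phid f x) m).
have PhiP x : balanced (fun (f : M') m => lact (phid f x) m).
  split=> [f1 f2 m|f m1 m2|f a m]; rewrite ?lactDr //.
    by rewrite !phidE pureDr raddfD lactDl.
  by rewrite !phidE -lactA -(tensor_ractE x f a) [phi _]phiR.
pose theta x := Phi x (psiV 1).
have PhiR x t a' : Phi x (tensor_ract t a') = ract (Phi x t) a'.
  have [s ->] := tensor_sumP t; rewrite {2}/Phi tensor_lift_pures //.
  rewrite /tensor_ract tensor_lift_pures; last exact: tensor_ract_balanced.
  rewrite /Phi tensor_lift_sum // ract_suml; apply: eq_bigr => p _.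
  by rewrite tensor_lift_pure // lractA.
have thetaM x a' : Phi x (psiV a') = ract (theta x) a'.
  rewrite -PhiR; congr (Phi x _); apply: (can_inj psiK).
  by rewrite psiVK [RHS](psiR (psiV 1)) /= psiVK mul1r.
(* A right inverse of theta, built from phi^-1(1) as theta is from psi^-1(1). *)
pose eta (y : M) : M := \sum_(p <- sphi) ract p.1 (psi (tpure p.2 y)).
pose Psi (y : M) : tensor M M' -> M :=
  tensor_lift (fun m (f : M') => ract m (psi (tpure f y))).
have PsiP y : balanced (fun m (f : M') => ract m (psi (tpure f y))).
  split=> [m1 m2 f|m f1 f2|m a f]; rewrite ?ractDl //.
    by rewrite pureDl raddfD ractDr.
  by rewrite -ractA -(tensor_lactE a f y) [psi (_ _ (tpure f y))]psiL.
have etaE y : eta y = Psi y (phiV 1).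
  by rewrite sphiE /Psi tensor_lift_pures.
have thetaK y : theta (eta y) = y.
  have thetaD x1 x2 : theta (x1 + x2) = theta x1 + theta x2.
    rewrite /theta /Phi spsiE !tensor_lift_pures // -big_split /=.
    by apply: eq_bigr => p _; rewrite dualD lactDl.
  have theta0 : theta 0 = 0 by apply: (addIr (theta 0)); rewrite -thetaD !add0r.
  (* psi^-1(a') is both a' psi^-1(1) and psi^-1(1) a', because psi is a bimodule map; this carries
     a' across the tensors. *)
  have thetaR x a' : theta (ract x a') = ract (theta x) a'.
    rewrite -thetaM; have -> : psiV a' = tensor_lact a' (psiV 1).
      by apply: (can_inj psiK); rewrite psiVK [RHS](psiL a' (psiV 1)) /= psiVK mulr1.
    rewrite spsiE /tensor_lact tensor_lift_pures; last exact: tensor_lact_balanced.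
    rewrite /theta /Phi spsiE tensor_lift_pures // tensor_lift_sum //.
    by apply: eq_bigr => p _; rewrite tensor_lift_pure // !phidE pureA.
  rewrite /eta (big_morph theta thetaD theta0).
  transitivity (\sum_(p <- sphi) lact (phi (tpure p.1 p.2)) y).
    apply: eq_bigr => p _; rewrite thetaR -thetaM psiK /Phi tensor_lift_pure //.
    by rewrite phidE.
  by rewrite -lact_suml -raddf_sum -sphiE phiVK lact1.
have etaD x y : eta (x + y) = eta x + eta y.
  by rewrite /eta -big_split; apply: eq_bigr => p _; rewrite pureDr raddfD ractDr.
have etaL a y : eta (lact a y) = lact a (eta y).
  (* The two expressions of phi^-1(a) give eta (a y) and a (eta y) respectively. *)
  have eR : phiV a = tensor_ract (phiV 1) a.
    by apply: (can_inj phiK); rewrite phiVK [RHS](phiR (phiV 1)) /= phiVK mul1r.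
  have eL : phiV a = tensor_lact a (phiV 1).
    by apply: (can_inj phiK); rewrite phiVK [RHS](phiL a (phiV 1)) /= phiVK mulr1.
  transitivity (Psi y (phiV a)).
    rewrite eR /eta sphiE /tensor_ract tensor_lift_pures; last exact: tensor_ract_balanced.
    by rewrite /Psi tensor_lift_sum //; apply: eq_bigr => p _; rewrite tensor_lift_pure // pureA.
  rewrite eL /eta sphiE /tensor_lact tensor_lift_pures; last exact: tensor_lact_balanced.
  rewrite /Psi tensor_lift_sum // lact_sumr; apply: eq_bigr => p _.
  by rewrite tensor_lift_pure // lractA.
split.
- exists [seq (p.1, phid p.2) | p <- sphi]; rewrite big_map /=.
  transitivity (phi (phiV 1)); last exact: phiVK.
  by rewrite sphiE raddf_sum; apply: eq_bigr => p _; rewrite phidE.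
- have gP (f : mdual M) : exists f' : mdual M, forall m, f' m = f (eta m).
    by apply: mk_dual; split=> [m1 m2|a m]; rewrite ?etaD ?dualD // etaL dualZ.
  have [g gE] := choice gP.
  exists [seq (p.2, g (phid p.1)) | p <- spsi] => m; rewrite big_map /=.
  rewrite -{1}[m]thetaK /theta spsiE /Phi tensor_lift_pures //.
  by apply: eq_bigr => p _; rewrite gE.
(* Applying u to the second factors of psi^-1(1) = sum f # m makes right multiplication by a' agree
   with u on theta (eta x) = x. *)
- move=> u uD uL; pose a' := psi (\sum_(p <- spsi) tpure p.1 (u p.2)).
  have u0 : u 0 = 0 by apply: (addIr (u 0)); rewrite -uD !add0r.
  exists a' => x; rewrite -[x]thetaK -thetaM psiK /Phi tensor_lift_sum //.
  rewrite /theta /Phi spsiE tensor_lift_pures // (big_morph u uD u0).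
  by apply: eq_bigr => p _; rewrite uL tensor_lift_pure.
move=> a' Ma'; rewrite -[a']mul1r -[1]psiVK -[RHS](raddf0 psi).
rewrite -[LHS](psiR _ a') spsiE; congr (psi _).
rewrite /= /tensor_ract tensor_lift_pures; last exact: tensor_ract_balanced.
by rewrite big1 // => p _; rewrite Ma' pure0r.
Qed.

End Criterion.

Lemma proj0 (Q : finType) (V : zmodType) (V_ : Q -> V -> Prop) pr q :
  is_projection V_ pr -> pr q 0 = 0.
Proof. by move=> [prD _ _ _]; apply: (addIr (pr q 0)); rewrite -prD !add0r. Qed.

Lemma proj_sum (Q : finType) (V : zmodType) (V_ : Q -> V -> Prop) pr q :
  is_projection V_ pr -> forall I (s : seq I) P (F : I -> V),
  pr q (\sum_(i <- s | P i) F i) = \sum_(i <- s | P i) pr q (F i).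
Proof.
by move=> prP I s P F; have [prD _ _ _] := prP; exact: (big_morph _ (prD q) (proj0 q prP)).
Qed.

Section GradedIso.
Variables (Q : finGroupType) (A A' : gring Q) (M N : gbimod A A') (f : M -> N).

(** The source need only be spanned by its components: if f m has degree q, uniqueness in the target
    kills the images of the other parts of m, and injectivity leaves m equal to its q-part. This
    suits tensor products, whose sum is not known in advance to be direct. *)
Lemma gbimod_iso_homogeneous :
    (forall x y, f (x - y) = f x - f y) ->
    (forall x, f x = 0 -> x = 0) -> (forall y, exists x, f x = y) ->
    (forall (a : A) m, f (lact a m) = lact a (f m)) ->
    (forall m (a' : A'), f (ract m a') = ract (f m) a') ->
    (forall q m, gcomp q m -> gcomp q (f m)) ->
    (forall m, exists2 T : Q -> M, forall q, gcomp q (T q) & m = \sum_q T q) ->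
    is_direct_sum (@gcomp _ _ _ N) ->
  gbimod_iso M N.
Proof.
move=> fB finj fsurj fL fR fgr spanM dsN.
pose fa : {additive M -> N} := HB.pack f (GRing.isZmodMorphism.Build M N f fB).
have {}finj : injective f.
  by move=> x y e; apply/eqP; rewrite -subr_eq0; apply/eqP/finj; rewrite fB e subrr.
exists fa; split=> // [|q m]; first exact: bij_inj_surj.
split=> [|fm]; first exact: fgr.
have [T TM mE] := spanM m; have [pr prP] := direct_sum_proj dsN.
have [_ _ _ prE] := prP.
have fT r : f (T r) = if q == r then f m else 0.
  have := prE r q (f m) fm; rewrite eq_sym => <-.
  rewrite mE -[f (\sum_q _)]/(fa _) raddf_sum (proj_sum r prP) (bigD1 r) //=.
  rewrite (prE r r) ?eqxx ?big1 ?addr0 //; last exact/fgr.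
  by move=> s sr; rewrite (prE r s) ?[r == s]eq_sym ?(negPf sr) //; exact/fgr.
by rewrite -[m](finj (T q)) ?fT ?eqxx.
Qed.
End GradedIso.

Section HomogeneousTensors.
Variables (Q : finGroupType) (A B D : gring Q) (M : gbimod A B) (N : gbimod B D).
Hypothesis spanM :
  forall m : M, exists2 T : Q -> M, forall q, gcomp q (T q) & m = \sum_q T q.
Hypothesis spanN :
  forall m : N, exists2 T : Q -> N, forall q, gcomp q (T q) & m = \sum_q T q.

(** The q-part of m # n collects the products m_x # n_y with x y = q. *)
Lemma tensor_span (t : gtensor M N) :
  exists2 T : Q -> gtensor M N, forall q, gcomp q (T q) & t = \sum_q T q.
Proof.
pose S (t : tensor M N) := exists2 T : Q -> gtensor M N,
  forall q, gcomp q (T q) & t = \sum_q T q.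
apply: (@tensor_gen _ _ _ _ M N S) t => [|m n].
  split=> [|_ _ [T TP ->] [T' TP' ->]].
    by exists (fun=> 0) => [q|]; rewrite ?big1 // => ? [].
  exists (fun q => T q - T' q) => [q U sgU UP|]; last by rewrite sumrB.
  by apply: sgU.2; [exact: TP|exact: TP'].
have [T TP {1}->] := spanM m; have [T' TP' {1}->] := spanN n.
exists (fun q => \sum_x tpure (T x) (T' (x^-1 * q)%g)) => [q U [U0 UB] UP|].
  have UD x y : U x -> U y -> U (x + y).
    by move=> Ux Uy; rewrite -[y]opprK -[- y]sub0r; apply/UB/UB.
  apply: (big_ind U) => // x _; apply: UP; apply: TensorHom (TP x) (TP' _).
  by rewrite mulKVg.
rewrite exchange_big pure_suml; apply: eq_bigr => x _.
by rewrite pure_sumr (reindex_inj (mulgI x^-1%g)).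
Qed.
End HomogeneousTensors.

Section GradedMorita.
Variables (Q : finGroupType) (A A' : gring Q) (M : gbimod A A').
Hypotheses (gA : graded_bimodule (greg A)) (gA' : graded_bimodule (greg A')).
Hypotheses (A1 : gring_comp 1%g (1 : A)) (A'1 : gring_comp 1%g (1 : A')).
Hypothesis gM : graded_bimodule M.

Lemma gring_compM g h (a1 a2 : A) :
  gring_comp g a1 -> gring_comp h a2 -> gring_comp (g * h)%g (a1 * a2).
Proof.
by move=> a1g a2h; have := gA.2 g h 1%g a1 a2 1 a1g a2h A1; rewrite /= mulr1 mulg1.
Qed.

Lemma lact_comp g h (a : A) (m : M) :
  gring_comp g a -> gcomp h m -> gcomp (g * h)%g (lact a m).
Proof. by move=> ag mh; have := gM.2 g h 1%g a m 1 ag mh A'1; rewrite ract1 mulg1. Qed.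

Lemma ract_comp g h (m : M) (a' : A') :
  gcomp g m -> gring_comp h a' -> gcomp (g * h)%g (ract m a').
Proof. by move=> mg ah; have := gM.2 1%g g h 1 m a' A1 mg ah; rewrite lact1 mul1g. Qed.

Lemma proj_lact prM : is_projection (@gcomp _ _ _ M) prM ->
  forall g k (a : A) (m : M), gring_comp k a ->
  prM g (lact a m) = lact a (prM (k^-1 * g)%g m).
Proof.
move=> prMP g k a m ak; have [prMD prMc prMS prME] := prMP.
rewrite {1}[m]prMS lact_sumr (proj_sum _ prMP) (bigD1 (k^-1 * g)%g) //=.
rewrite (prME g g) ?eqxx; last by rewrite -{1}[g](mulKVg k); apply: lact_comp.
rewrite big1 ?addr0 // => x xk; rewrite (prME g (k * x)%g); last exact: lact_comp.
by case: eqP => // gE; case/eqP: xk; rewrite gE mulKg.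
Qed.

(** The x-part of f keeps, on M_g, the component of f in degree g x. As Q is finite, these parts add
    up to f. *)
Lemma dual_parts prA (f : mdual M) : is_projection (@gring_comp _ A) prA ->
  exists F : Q -> mdual M, [/\ forall x, dual_comp x (F x), f = \sum_x F x
    & forall x g m, gcomp g m -> F x m = prA (g * x)%g (f m)].
Proof.
move=> prAP; have [prAD prAc prAS prAE] := prAP.
have [prM prMP] := direct_sum_proj gM.1; have [prMD prMc prMS prME] := prMP.
have lactP := proj_lact prMP.
have mulP g k (a a1 : A) : gring_comp k a -> prA (k * g)%g (a * a1) = a * prA g a1.
  move=> ak; rewrite {1}[a1]prAS mulr_sumr (proj_sum _ prAP) (bigD1 g) //=.
  rewrite (prAE _ (k * g)%g) ?eqxx; last exact: gring_compM.
  rewrite big1 ?addr0 // => x xk; rewrite (prAE _ (k * x)%g); last exact: gring_compM.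
  by case: eqP => // /mulgI xE; case/eqP: xk.
have FP x : exists F : mdual M, forall m, F m = \sum_g prA (g * x)%g (f (prM g m)).
  apply: mk_dual; split=> [m1 m2|a m].
    by rewrite -big_split /=; apply: eq_bigr => g _; rewrite prMD dualD prAD.
  rewrite [a]prAS lact_suml mulr_suml.
  transitivity (\sum_g \sum_k prA (g * x)%g (f (prM g (lact (prA k a) m)))).
    apply: eq_bigr => g _; rewrite (proj_sum _ prMP) dual_sum.
    by rewrite (proj_sum _ prAP).
  rewrite exchange_big; apply: eq_bigr => k _; rewrite mulr_sumr.
  rewrite (reindex_inj (mulgI k)); apply: eq_bigr => g _ /=.
  by rewrite (lactP _ k) // mulKg dualZ -mulgA mulP.
have [F FE] := choice FP.
have FH x g m : gcomp g m -> F x m = prA (g * x)%g (f m).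
  move=> mg; rewrite FE (bigD1 g) //= (prME g g) // eqxx big1 ?addr0 // => h hg.
  by rewrite (prME h g) // (negPf hg) dual0 (proj0 _ prAP).
exists F; split=> // [x g m mg|]; first by rewrite (FH x g m mg).
apply: dual_ext => m; rewrite mdual_sumE [m]prMS dual_sum.
under [RHS]eq_bigr => x _ do rewrite dual_sum.
rewrite exchange_big; apply: eq_bigr => g _ /=.
rewrite [LHS]prAS (reindex_inj (mulgI g)); apply: eq_bigr => x _ /=.
by rewrite (FH x g).
Qed.

(** The component of a' in a degree r other than q sends M_g to degree g r, where a' has no
    contribution; so it annihilates M and is 0 by faithfulness. *)
Lemma ract_homogeneous q (a' : A') : (forall a' : A', (forall x : M, ract x a' = 0) -> a' = 0) ->
  (forall g (m : M), gcomp g m -> gcomp (g * q)%g (ract m a')) -> gring_comp q a'.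
Proof.
move=> faithM a'q; have [pr prP] := direct_sum_proj gA'.1.
have [prD prc prS prE] := prP.
have [prM prMP] := direct_sum_proj gM.1; have [prMD prMc prMS prME] := prMP.
suff pr0 r : r != q -> pr r a' = 0.
  rewrite [a']prS (bigD1 q) //= big1; first by rewrite addr0; apply: prc.
  by move=> r; apply: pr0.
move=> rq; apply: faithM => m; rewrite [m]prMS ract_suml big1 // => g _.
have mg := prMc g m; move: (prM g m) mg => {}m mg.
have := prME (g * r)%g (g * q)%g _ (a'q _ _ mg).
rewrite (inj_eq (mulgI g)) (negPf rq) {1}[a']prS ract_sumr (proj_sum _ prMP).
rewrite (bigD1 r) //= (prME _ (g * r)%g) ?eqxx; last exact: ract_comp mg (prc _ _).
rewrite big1 ?addr0 // => s sr; rewrite (prME _ (g * s)%g); last exact: ract_comp mg (prc _ _).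
by rewrite (inj_eq (mulgI g)) eq_sym (negPf sr).
Qed.

(** The maps are evaluation m # f |-> f(m) and f # m |-> c(f, m), the element of A' acting as the
    rank one endomorphism x |-> f(x) m. Generation makes the first bijective and the dual basis the
    second. *)
Lemma criterion_graded_morita : morita_criterion M ->
  gbimod_iso (gtensor M (gdual M)) (greg A) /\
  gbimod_iso (gtensor (gdual M) M) (greg A').
Proof.
move=> [[s1 s1E] [s2 s2E] endM faithM].
have spanM (m : M) : exists2 T : Q -> M, forall q, gcomp q (T q) & m = \sum_q T q.
  by have [_ + _] := gM.1; apply.
have [prA prAP] := direct_sum_proj gA.1.
have spanM' (f : gdual M) :
    exists2 T : Q -> gdual M, forall q, gcomp q (T q) & f = \sum_q T q.
  by have [F [Fc FS _]] := dual_parts f prAP; exists F.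
have rankone (f : mdual M) (m : M) : exists a' : A', forall x, lact (f x) m = ract x a'.
  by apply: endM => [x y|a x]; rewrite ?dualD ?lactDl // dualZ lactA.
have [c cE] : exists c : mdual M * M -> A',
      forall (p : mdual M * M) x, lact (p.1 x) p.2 = ract x (c p).
  have [c cE] := choice (fun p : mdual M * M => rankone p.1 p.2).
  by exists c.
have faith_eq (a1 a2 : A') : (forall x : M, ract x a1 = ract x a2) -> a1 = a2.
  move=> e; apply/eqP; rewrite -subr_eq0; apply/eqP/faithM => x.
  by rewrite ractBr e subrr.
pose ev : gtensor M (gdual M) -> greg A := tensor_lift (fun m (f : gdual M) => (f : mdual M) m).
have evP : @balanced _ _ _ _ M (gdual M) (greg A) (fun m (f : gdual M) => (f : mdual M) m).
  by split=> [m1 m2 f|m f1 f2|m a f] //; rewrite dualD.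
pose cc : gtensor (gdual M) M -> greg A' := tensor_lift (fun (f : gdual M) m => c (f, m)).
have ccP : @balanced _ _ _ _ (gdual M) M (greg A') (fun (f : gdual M) m => c (f, m)).
  split=> [f1 f2 m|f m1 m2|f a m]; apply: faith_eq => x; rewrite -?ractDr ?ractDr -!cE /=.
  - by rewrite lactDl.
  - by rewrite lactDr.
  - by rewrite lactA.
split.
- apply: (@gbimod_iso_homogeneous _ _ _ _ _ ev).
  + exact: tensor_liftB.
  + move=> t; have [s ->] := tensor_sumP t; rewrite /ev tensor_lift_pures // => e.
    (* With 1 = sum g_i(m_i), each f equals f 1 = sum c(f, m_i) g_i. Moving c(f, m_i) to the left
       factor turns sum m # f into sum_i (sum f(m)) m_i # g_i. *)
    transitivity (\sum_(i <- s1) \sum_(p <- s)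
        tpure (ract p.1 (c (p.2 : mdual M, i.1))) (i.2 : gdual M)).
      rewrite exchange_big; apply: eq_bigr => p _ /=.
      transitivity (tpure p.1 (dual_ract p.2 1 : gdual M)).
        by congr (tpure _ _); apply: dual_ext => x /=; rewrite mulr1.
      rewrite -s1E.
      have -> : dual_ract p.2 (\sum_(i <- s1) i.2 i.1) =
                \sum_(i <- s1) dual_lact (c (p.2 : mdual M, i.1)) i.2.
        apply: dual_ext => x; rewrite mdual_sumE /= mulr_sumr.
        by apply: eq_bigr => i _; rewrite -cE dualZ.
      by rewrite pure_sumr; apply: eq_bigr => i _; rewrite pureA.
    rewrite big1 // => i _; rewrite -pure_suml.
    under eq_bigr => p _ do rewrite -cE /=.
    by rewrite -lact_suml e lact0l pure0l.
  + move=> a; exists (\sum_(p <- s1) tpure (lact a p.1) (p.2 : gdual M)).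
    rewrite /ev (tensor_lift_sum evP) -[RHS]mulr1 -s1E mulr_sumr.
    by apply: eq_bigr => p _; rewrite (tensor_lift_pure evP) dualZ.
  + move=> a t; have [s ->] := tensor_sumP t.
    rewrite /= /tensor_lact tensor_lift_pures; last exact: tensor_lact_balanced.
    rewrite /ev !tensor_lift_sum // mulr_sumr; apply: eq_bigr => p _.
    by rewrite !tensor_lift_pure // dualZ.
  + move=> t a; have [s ->] := tensor_sumP t.
    rewrite /= /tensor_ract tensor_lift_pures; last exact: tensor_ract_balanced.
    rewrite /ev !tensor_lift_sum // mulr_suml; apply: eq_bigr => p _.
    by rewrite !tensor_lift_pure.
  + move=> q t /(_ (fun t => gring_comp q (ev t))); apply.
      have sgA : is_subgroup (@gring_comp _ A q) by have [+ _ _] := gA.1; apply.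
      split=> [|x y xq yq]; first by rewrite /ev tensor_lift0 //; apply: sgA.1.
      by rewrite /ev tensor_liftB //; apply: sgA.2.
    move=> _ [g h m f <- mg fh]; rewrite /ev tensor_lift_pure //; exact: fh.
  + exact: tensor_span.
  + exact: gA.1.
apply: (@gbimod_iso_homogeneous _ _ _ _ _ cc).
- exact: tensor_liftB.
- move=> t; have [s ->] := tensor_sumP t; rewrite /cc tensor_lift_pures // => e.
  (* Expanding the right factors in the dual basis puts the scalars g_i(m) on the left; at x the
     left factor is then g_i(sum f(x) m) = g_i(x sum c(f, m)). *)
  transitivity (\sum_(i <- s2) \sum_(p <- s)
      tpure (dual_ract (p.1 : mdual M) (i.2 p.2) : gdual M) i.1).
    rewrite exchange_big; apply: eq_bigr => p _ /=.
    rewrite {1}[p.2]s2E pure_sumr; apply: eq_bigr => i _.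
    by rewrite -pureA.
  rewrite big1 // => i _; rewrite -pure_suml.
  rewrite (_ : \sum_(p <- s) _ = 0) ?pure0l //.
  apply: dual_ext => x; rewrite mdual_sumE mdual0E /=.
  transitivity (i.2 (\sum_(p <- s) lact ((p.1 : mdual M) x) p.2)).
    by rewrite dual_sum; apply: eq_bigr => p _; rewrite dualZ.
  transitivity (i.2 (ract x (\sum_(p <- s) c (p.1, p.2)))).
    by congr (i.2 _); rewrite ract_sumr; apply: eq_bigr => p _; rewrite -cE.
  by rewrite e ract0r dual0.
- have c1 : \sum_(i <- s2) c (i.2, i.1) = 1.
    apply: faith_eq => x; rewrite ract1 ract_sumr [RHS]s2E.
    by apply: eq_bigr => i _; rewrite -cE.
  move=> a; exists (\sum_(p <- s2) tpure (p.2 : gdual M) (ract p.1 a)).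
  rewrite /cc (tensor_lift_sum ccP) -[RHS]mul1r -c1 mulr_suml.
  apply: eq_bigr => p _; rewrite (tensor_lift_pure ccP); apply: faith_eq => x.
  by rewrite -cE /= -lractA [lact _ _](cE (p.2, p.1)) ractA.
- move=> a t; have [s ->] := tensor_sumP t.
  rewrite /= /tensor_lact tensor_lift_pures; last exact: tensor_lact_balanced.
  rewrite /cc !tensor_lift_sum // mulr_sumr; apply: eq_bigr => p _.
  rewrite !tensor_lift_pure //; apply: faith_eq => x.
  by rewrite ractA -!cE.
- move=> t a; have [s ->] := tensor_sumP t.
  rewrite /= /tensor_ract tensor_lift_pures; last exact: tensor_ract_balanced.
  rewrite /cc !tensor_lift_sum // mulr_suml; apply: eq_bigr => p _.
  rewrite !tensor_lift_pure //; apply: faith_eq => x.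
  by rewrite ractA -!cE /= lractA.
- move=> q t /(_ (fun t => gring_comp q (cc t))); apply.
    have sgA : is_subgroup (@gring_comp _ A' q) by have [+ _ _] := gA'.1; apply.
    split=> [|x y xq yq]; first by rewrite /cc tensor_lift0 //; apply: sgA.1.
    by rewrite /cc tensor_liftB //; apply: sgA.2.
  move=> _ [g h f m <- fg mh]; rewrite /cc tensor_lift_pure //.
  apply: ract_homogeneous => // x n nx; rewrite -cE /= mulgA.
  by apply: lact_comp => //; apply: fg.
- exact: tensor_span.
- exact: gA'.1.
Qed.

(** * Generators and dual bases in degree 1 *)

Definition has_units (B : gring Q) : Prop :=
  forall x, exists u v : B, [/\ gring_comp x u, gring_comp x^-1%g v & u * v = 1].

(** Take the degree 1 part of sum f(m) = 1, split each m into parts m_x, and write f(m_x) = f((m_x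
    u) v) with u v = 1 and u of degree x^-1: then m_x u has degree 1, and the form is the degree 1
    part of y |-> f(y v). *)
Lemma degree1_generation (s : seq (M * mdual M)) :
  has_units A' -> \sum_(p <- s) p.2 p.1 = 1 ->
  exists (I : finType) (m : I -> M) (f : I -> mdual M),
    [/\ forall i, gcomp 1%g (m i), forall i, dual_comp 1%g (f i)
      & \sum_i f i (m i) = 1].
Proof.
move=> unitsA' s1; pose p0 := (0, 0) : M * mdual M.
have [prA prAP] := direct_sum_proj gA.1; have [prAD prAc prAS prAE] := prAP.
have [prM prMP] := direct_sum_proj gM.1; have [prMD prMc prMS prME] := prMP.
have [u uP] := choice (fun x => unitsA' x^-1%g); have [v uvP] := choice uP.
pose I := ('I_(size s) * Q)%type; pose p (i : 'I_(size s)) := nth p0 s i.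
have fP (j : I) : exists f' : mdual M, dual_comp 1%g f' /\
    forall m, gcomp 1%g m -> f' m = prA 1%g ((p j.1).2 (ract m (v j.2))).
  have [F [Fc _ FE]] := dual_parts (dual_lact (v j.2) (p j.1).2) prAP.
  by exists (F 1%g); split=> // m m1; rewrite (FE 1%g 1%g) // mulg1.
have [f fE] := choice fP.
have mc (j : I) : gcomp 1%g (ract (prM j.2 (p j.1).1) (u j.2)).
  have [uc _ _] := uvP j.2.
  by rewrite -[1%g](mulgV j.2); apply: ract_comp uc; apply: prMc.
exists I, (fun j => ract (prM j.2 (p j.1).1) (u j.2)), f; split=> //.
  by move=> j; have [] := fE j.
transitivity (\sum_(j : I) prA 1%g ((p j.1).2 (prM j.2 (p j.1).1))).
  apply: eq_bigr => j _; have [_ ->] := fE j; last exact: mc.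
  by have [_ _ uv] := uvP j.2; rewrite -ractA uv ract1.
rewrite -(pair_big xpredT xpredT (fun i x => prA 1%g ((p i).2 (prM x (p i).1)))) /=.
under eq_bigr => i _ do rewrite -(proj_sum _ prAP) -dual_sum -prMS.
rewrite -(proj_sum _ prAP) (_ : \sum_i _ = 1) ?(prAE _ 1%g) ?eqxx //.
by rewrite -s1 (big_nth p0) big_mkord.
Qed.

(** Here 1 = u v, with u of degree x, is inserted on the other side: f(y) m_x = (f(y) u)(v m_x). The
    new basis elements are the v m_x, the new forms the degree 1 parts of f u. *)
Lemma degree1_dual_basis (s : seq (M * mdual M)) :
  has_units A -> (forall x : M, x = \sum_(p <- s) lact (p.2 x) p.1) ->
  exists (I : finType) (m : I -> M) (f : I -> mdual M),
    [/\ forall i, gcomp 1%g (m i), forall i, dual_comp 1%g (f i)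
      & forall x : M, x = \sum_i lact (f i x) (m i)].
Proof.
move=> unitsA sP; pose p0 := (0, 0) : M * mdual M.
have [prA prAP] := direct_sum_proj gA.1; have [prAD prAc prAS prAE] := prAP.
have [prM prMP] := direct_sum_proj gM.1; have [prMD prMc prMS prME] := prMP.
have [u uP] := choice unitsA; have [v uvP] := choice uP.
pose I := ('I_(size s) * Q)%type; pose p (i : 'I_(size s)) := nth p0 s i.
have fP (j : I) : exists f' : mdual M, dual_comp 1%g f' /\
    forall g m, gcomp g m -> f' m = prA g ((p j.1).2 m * u j.2).
  have [F [Fc _ FE]] := dual_parts (dual_ract (p j.1).2 (u j.2)) prAP.
  by exists (F 1%g); split=> // g m mg; rewrite (FE 1%g g) // mulg1.
have [f fE] := choice fP; pose n (j : I) := lact (v j.2) (prM j.2 (p j.1).1).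
have nc j : gcomp 1%g (n j).
  have [_ vc _] := uvP j.2.
  by rewrite -[1%g](mulVg j.2); apply: lact_comp vc _; apply: prMc.
have key g (w : A) (m : M) :
    prM g (lact w m) = \sum_x lact (prA g (w * u x)) (lact (v x) (prM x m)).
  rewrite [w]prAS lact_suml (proj_sum _ prMP).
  under [RHS]eq_bigr => x _ do rewrite mulr_suml (proj_sum _ prAP) lact_suml.
  rewrite exchange_big; apply: eq_bigr => z _ /=.
  have wz := prAc z w; rewrite (proj_lact prMP _ _ wz) (bigD1 (z^-1 * g)%g) //=.
  rewrite big1 ?addr0 => [|x xz].
    have [ug _ uvg] := uvP (z^-1 * g)%g.
    rewrite (prAE g g) ?eqxx; last by have := gring_compM wz ug; rewrite mulKVg.
    by rewrite lactA -[lact (u _) _]lactA uvg lact1.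
  have [ux vx uv] := uvP x; rewrite (prAE g (z * x)%g); last exact: gring_compM.
  by case: eqP => [gE|_]; [case/eqP: xz; rewrite gE mulKg|rewrite lact0l].
exists I, n, f; split=> // [j|x]; first by have [] := fE j.
have hom g y : gcomp g y -> y = \sum_i lact (f i y) (n i).
  move=> yg; transitivity (prM g y); first by rewrite (prME _ g) ?eqxx.
  rewrite {1}[y]sP (proj_sum _ prMP) (big_nth p0) big_mkord.
  under eq_bigr => i _ do rewrite key.
  rewrite (pair_big xpredT xpredT) /=; apply: eq_bigr => j _.
  by have [_ fg] := fE j; rewrite (fg g).
rewrite {1}[x]prMS.
transitivity (\sum_g \sum_i lact (f i (prM g x)) (n i)).
  by apply: eq_bigr => g _; apply: hom (prMc g x).
rewrite exchange_big; apply: eq_bigr => i _ /=.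
by rewrite -lact_suml -dual_sum -prMS.
Qed.

End GradedMorita.

(** * Group algebras and block extensions *)

Section GroupAlgebraTheory.
Variables (R : comNzRingType) (gT : finGroupType).
Implicit Types (a b c e : galg R gT) (g h : gT) (X : {set gT}) (H : {group gT}).

Lemma gcoefM a b g : gcoef (a * b) g = \sum_h gcoef a h * gcoef b (h^-1 * g)%g.
Proof. exact: gmulE. Qed.

Lemma gcoefZ (r : R) a g : gcoef (r *: a) g = r * gcoef a g.
Proof. by rewrite /gcoef ffunE. Qed.

Lemma gcoef_sum I (s : seq I) P (F : I -> galg R gT) g :
  gcoef (\sum_(i <- s | P i) F i) g = \sum_(i <- s | P i) gcoef (F i) g.
Proof. by apply: (big_morph (fun a => gcoef a g)) => [a b|]; rewrite ?gaddE ?gzeroE. Qed.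

Lemma gcoef_baseMl g a h : gcoef (gbase R g * a) h = gcoef a (g^-1 * h)%g.
Proof.
rewrite gcoefM (bigD1 g) //= gbaseE eqxx mul1r big1 ?addr0 // => k kg.
by rewrite gbaseE (negPf kg) mul0r.
Qed.

Lemma gcoef_baseMr g a h : gcoef (a * gbase R g) h = gcoef a (h * g^-1)%g.
Proof.
rewrite gcoefM (bigD1 (h * g^-1)%g) //= gbaseE invMg invgK mulgKV eqxx mulr1.
rewrite big1 ?addr0 // => k kg; rewrite gbaseE; case: eqP => [gE|_]; last by rewrite mulr0.
by case/eqP: kg; rewrite -gE invMg invgK mulKVg.
Qed.

Lemma gbaseM g h : gbase R g * gbase R h = gbase R (g * h)%g.
Proof.
by apply/galgP => k; rewrite gcoef_baseMl !gbaseE -(inj_eq (mulgI g)) mulKVg.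
Qed.

Lemma gbase1 : gbase R 1%g = 1 :> galg R gT. Proof. by []. Qed.

Lemma gconjE g a h : gcoef (gconj g a) h = gcoef a (h ^ g)%g.
Proof. by rewrite /gconj gcoef_baseMr gcoef_baseMl invgK conjgE. Qed.

Lemma scale_galgAl (r : R) a b : r *: (a * b) = (r *: a) * b.
Proof.
apply/galgP => g; rewrite gcoefZ !gcoefM mulr_sumr.
by apply: eq_bigr => h _; rewrite gcoefZ mulrA.
Qed.

Lemma scale_galgAr (r : R) a b : r *: (a * b) = a * (r *: b).
Proof.
apply/galgP => g; rewrite gcoefZ !gcoefM mulr_sumr.
by apply: eq_bigr => h _; rewrite gcoefZ mulrCA.
Qed.

Lemma galg_sum X a : gspan X a -> a = \sum_(g in X) gcoef a g *: gbase R g.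
Proof.
move=> /gspanP aX; apply/galgP => h; rewrite gcoef_sum.
have [hX|hX] := boolP (h \in X).
  rewrite (bigD1 h) //= gcoefZ gbaseE eqxx mulr1 big1 ?addr0 // => g /andP[_ gh].
  by rewrite gcoefZ gbaseE eq_sym (negPf gh) mulr0.
rewrite aX // big1 // => g gX; rewrite gcoefZ gbaseE; case: eqP => [hE|_]; last exact: mulr0.
by rewrite -hE (negPf hX) in gX.
Qed.

Lemma gspanZ X r a : gspan X a -> gspan X (r *: a).
Proof. by move=> /gspanP aX; apply/gspanP => g gX; rewrite gcoefZ aX ?mulr0. Qed.

Lemma gspan_base X g : g \in X -> gspan X (gbase R g).
Proof. by move=> gX; apply/gspanP => h; rewrite gbaseE; case: eqP => // ->; rewrite gX. Qed.

Lemma gspanS X (Y : {set gT}) a : X \subset Y -> gspan X a -> gspan Y a.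
Proof.
move=> sXY /gspanP aX; apply/gspanP => g.
by apply: contraNeq => /(contra_neqN (aX g))/negPn/(subsetP sXY).
Qed.

Lemma gconj_span X g a : g \in 'N(X)%g -> gspan X a -> gspan X (gconj g a).
Proof. by move=> gX /gspanP aX; apply/gspanP => y yX; rewrite gconjE aX // memJ_norm. Qed.

Lemma ginvariant_commute X e a : ginvariant X e -> gspan X a -> a * e = e * a.
Proof.
move=> eX aX; rewrite (galg_sum aX) mulr_suml mulr_sumr; apply: eq_bigr => g gX.
rewrite -scale_galgAl -scale_galgAr; congr (_ *: _).
by rewrite -{2}(eX g gX) /gconj -mulrA gbaseM mulVg gbase1 mulr1.
Qed.

End GroupAlgebraTheory.

(** What makes bRH a graded crossed product: the support puts b in degree 1, and invariance makes it
    commute with RH. *)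
Definition invariant_idempotent (R : comNzRingType) (gT : finGroupType)
    (N H : {group gT}) (b : galg R gT) : Prop :=
  [/\ gspan (H :&: N) b, b * b = b & ginvariant H b].

Section BlockExtensionTheory.
Variables (R : comNzRingType) (gT : finGroupType) (G N H : {group gT}).
Variable b : galg R gT.
Hypotheses (nsNG : (N <| G)%g) (sHG : H \subset G).
Hypothesis bP : invariant_idempotent N H b.
Local Notation A := (gbalg G N H b).

Definition quo (g : gT) : subg_of (G / N) := subg (G / N) (coset N g).

Lemma mem_coset_quo x g :
  (g \in set_of_coset (sgval x)) = (g \in G) && (quo g == x :> subg_of (G / N)).
Proof.
have /morphimP[h Nh hG xE] := subgP x.
rewrite xE val_coset // mem_rcoset; apply/idP/andP => [ghN|[gG /eqP quoE]].
  have gE : g = (g * h^-1 * h)%g by rewrite mulgKV.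
  have gG : g \in G.
    by rewrite gE groupM // (subsetP (normal_sub nsNG)).
  split=> //; rewrite -val_eqE /= subgK ?mem_quotient //.
  rewrite xE gE morphM ?(subsetP (normG N) _ ghN) //=.
  by rewrite [coset N (g * _)%g]coset_id ?mul1g.
have Ng := subsetP (normal_norm nsNG) g gG.
have /(congr1 val) := quoE; rewrite /= subgK ?mem_quotient // xE => e.
by rewrite -mem_rcoset -val_coset // -e val_coset // rcoset_refl.
Qed.

Lemma quoM g h : g \in G -> h \in G -> quo (g * h)%g = (quo g * quo h)%g.
Proof.
move=> gG hG; have nN := subsetP (normal_norm nsNG).
by rewrite /quo morphM ?nN // -subgM ?mem_quotient.
Qed.

Lemma quo1 : quo 1%g = 1%g.
Proof. by apply: (mulgI (quo 1%g)); rewrite -quoM // !mulg1. Qed.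

Lemma quoV g : g \in G -> quo g^-1%g = (quo g)^-1%g.
Proof. by move=> gG; apply: (mulgI (quo g)); rewrite -quoM ?groupV // !mulgV quo1. Qed.

Lemma quo_eq1 g : g \in G -> (quo g == 1%g) = (g \in N).
Proof.
move=> gG; have := mem_coset_quo 1%g g; rewrite gG /= => <-.
by rewrite genGid.
Qed.

Lemma quo_eq g h : g \in G -> h \in G -> (quo g == quo h) = (g^-1 * h \in N)%g.
Proof.
move=> gG hG; rewrite -quo_eq1 ?groupM ?groupV // quoM ?groupV // quoV //.
by rewrite -(inj_eq (mulgI (quo g)^-1%g)) mulVg eq_sym.
Qed.

Lemma quo_surj x : exists2 g, g \in G & quo g = x.
Proof.
have /morphimP[h Nh hG xE] := subgP x; exists h => //.
by apply: val_inj; rewrite /= subgK ?xE ?mem_quotient.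
Qed.

Lemma balg_valP (a : balg H b) :
  [/\ gspan H (balg_val a), b * balg_val a = balg_val a & balg_val a * b = balg_val a].
Proof.
have [bHN bb _] := bP; have bH : gspan H b by apply: gspanS bHN; apply: subsetIl.
by have /and3P[aH] := valP a; rewrite balg_unitE // => /eqP ba /eqP ab.
Qed.

Lemma balg_ofE c : gspan H c -> balg_val (balg_of H b c) = b * c.
Proof.
have [bHN bb bi] := bP; have bH : gspan H b by apply: gspanS bHN; apply: subsetIl.
move=> cH; apply: insubdK; rewrite unfold_in /in_balg !balg_unitE // gspanM //= mulrA bb eqxx /=.
by rewrite -mulrA (ginvariant_commute bi) // mulrA bb.
Qed.

Lemma balg_of_val (a : balg H b) : balg_of H b (balg_val a) = a.
Proof. by apply: val_inj => /=; have [aH ba _] := balg_valP a; rewrite balg_ofE. Qed.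

Lemma balg_of_mul c d : gspan H c -> gspan H d ->
  balg_of H b (c * d) = balg_of H b c * balg_of H b d.
Proof.
move=> cH dH; apply: val_inj; rewrite /= !balg_ofE ?gspanM //.
have [_ bb bi] := bP.
by rewrite [RHS]mulrA -[b * c * b]mulrA (ginvariant_commute bi cH) [b * (b * c)]mulrA bb mulrA.
Qed.

Lemma balg_ofD c d : gspan H c -> gspan H d ->
  balg_of H b (c + d) = balg_of H b c + balg_of H b d.
Proof.
move=> cH dH; have cdH : gspan H (c + d).
  by rewrite -[d]opprK -[- d]sub0r; apply/gspanB/gspanB => //; apply: gspan0.
by apply: val_inj; rewrite /= !balg_ofE // mulrDr.
Qed.

Lemma balg_of1 : balg_of H b 1 = 1.
Proof.
have [bHN bb _] := bP; have bH : gspan H b by apply: gspanS bHN; apply: subsetIl.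
apply: val_inj; rewrite /= balg_ofE ?balg_unitE ?mulr1 //.
by rewrite -gbase1; apply: gspan_base; apply: group1.
Qed.

Lemma balg_val_sum I (s : seq I) P (F : I -> balg H b) :
  balg_val (\sum_(i <- s | P i) F i) = \sum_(i <- s | P i) balg_val (F i).
Proof. exact: (raddf_sum (val : balg H b -> galg R gT)). Qed.

Lemma balg_of_comp x c : gspan H c -> gspan (set_of_coset (sgval x)) c ->
  gring_comp x (balg_of H b c : A).
Proof.
move=> cH /gspanP cx; apply/gspanP => g gx; rewrite balg_ofE // gcoefM big1 // => h _.
have [bHN _ _] := bP; have [hN|hN] := boolP (h \in H :&: N).
  rewrite cx ?mulr0 //; apply: contra gx; rewrite !mem_coset_quo => /andP[hgG /eqP <-].
  have hG : h \in G by case/setIP: hN => /(subsetP sHG).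
  have gG : g \in G by rewrite -[g](mulKVg h) groupM.
  rewrite gG quoM ?groupV //.
  have /eqP -> : quo h^-1%g == 1%g by rewrite quo_eq1 ?groupV //; case/setIP: hN.
  by rewrite mul1g eqxx.
by move/gspanP: bHN => ->; rewrite ?mul0r.
Qed.

Lemma balg_comp1 : gring_comp 1%g (1 : A).
Proof.
by rewrite -[1]balg_of1 -gbase1; apply: balg_of_comp; apply: gspan_base => //=.
Qed.

Lemma balg_compM x y (a c : A) :
  gring_comp x a -> gring_comp y c -> gring_comp (x * y)%g (a * c).
Proof.
move=> /gspanP ax /gspanP cy; apply/gspanP => g gxy; rewrite [LHS]gcoefM big1 // => h _.
have [hx|hx] := boolP (h \in set_of_coset (sgval x)); last by rewrite ax ?mul0r.
rewrite cy ?mulr0 //; apply: contra gxy; rewrite mem_coset_quo => /andP[hgG /eqP ey].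
move: hx; rewrite !mem_coset_quo => /andP[hG /eqP ex].
by rewrite -[g](mulKVg h) groupM // quoM // ex ey eqxx.
Qed.

Lemma gbalg_graded : graded_bimodule (greg A).
Proof.
split=> [|g x h a m c ag mx ch]; last by apply: balg_compM ch; apply: balg_compM.
split=> [q|v|f fc f0 q].
- split=> [|x y]; first exact: gspan0.
  by move=> xq yq; apply: gspanB.
- have [vH bv _] := balg_valP v.
  pose res (x : subg_of (G / N)) : galg R gT :=
    [ffun g => if g \in set_of_coset (sgval x) then gcoef (balg_val v) g else 0].
  have resE x g : gcoef (res x) g =
      if g \in set_of_coset (sgval x) then gcoef (balg_val v) g else 0.
    by rewrite {1}/gcoef ffunE.
  have resH x : gspan H (res x).
    by apply/gspanP => g gH; rewrite resE; case: ifP => // _; move/gspanP: vH; apply.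
  exists (fun x => balg_of H b (res x)) => [x|].
    apply: balg_of_comp => //; apply/gspanP => g gx.
    by rewrite resE (negPf gx).
  apply: val_inj; rewrite /= balg_val_sum.
  under eq_bigr => x _ do rewrite balg_ofE //.
  rewrite -mulr_sumr -[LHS]bv; congr (_ * _); apply/galgP => g.
  rewrite gcoef_sum; have [gG|gG] := boolP (g \in G).
    rewrite (bigD1 (quo g)) //= resE mem_coset_quo gG eqxx /= big1 ?addr0 // => x xg.
    by rewrite resE mem_coset_quo eq_sym (negPf xg) andbF.
  rewrite big1 => [|x _]; last by rewrite resE mem_coset_quo (negPf gG).
  by move/gspanP: vH; apply; apply: contra gG; apply: (subsetP sHG).
apply: val_inj; apply/galgP => g; have /gspanP fq := fc q.
rewrite /= gzeroE; have [gq|/fq//] := boolP (g \in set_of_coset (sgval q)).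
have := congr1 (fun a : balg H b => gcoef (balg_val a) g) f0.
rewrite balg_val_sum gcoef_sum /= gzeroE (bigD1 q) //= big1 ?addr0 // => x xq.
have /gspanP := fc x; apply; move: gq; rewrite !mem_coset_quo => /andP[-> /eqP->].
by rewrite eq_sym (negPf xq).
Qed.

(** These monomials span A additively, so an action of A can be handled through them alone. *)
Definition gmon (c : R) (g : gT) : A := balg_of H b (c *: gbase R g).

Lemma gspan_mon c g : g \in H -> gspan H (c *: gbase R g).
Proof. by move=> gH; apply: gspanZ; apply: gspan_base. Qed.

Lemma gmonM c d g h : g \in H -> h \in H ->
  gmon c g * gmon d h = gmon (c * d) (g * h)%g.
Proof.
move=> gH hH; rewrite /gmon -balg_of_mul ?gspan_mon //; congr (balg_of _ _ _).
by rewrite -scale_galgAl -scale_galgAr gbaseM scalerA.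
Qed.

Lemma gmon11 : gmon 1 1%g = 1.
Proof. by rewrite /gmon scale1r gbase1 balg_of1. Qed.

Lemma gmonE c g : g \in H -> balg_val (gmon c g) = b * (c *: gbase R g).
Proof. by move=> gH; rewrite balg_ofE ?gspan_mon. Qed.

Lemma gmonD c d g : g \in H -> gmon (c + d) g = gmon c g + gmon d g.
Proof. by move=> gH; rewrite /gmon scalerDl; apply: balg_ofD; apply: gspan_mon. Qed.

Lemma gmon_comp c g : g \in H -> gring_comp (quo g) (gmon c g).
Proof.
move=> gH; apply: balg_of_comp; first exact: gspan_mon.
by apply/gspanZ/gspan_base; rewrite mem_coset_quo (subsetP sHG) // eqxx.
Qed.

Lemma gcoef_gmonMl c g a h : g \in H ->
  gcoef (balg_val (gmon c g * a)) h = c * gcoef (balg_val a) (g^-1 * h)%g.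
Proof.
move=> gH; have [aH ba ab] := balg_valP a; have [_ _ bi] := bP.
rewrite -[balg_val _]/(balg_val (gmon c g) * balg_val a) gmonE //.
rewrite -mulrA -(ginvariant_commute bi).
  by rewrite -mulrA ab -scale_galgAl gcoefZ gcoef_baseMl.
by apply: gspanM => //; apply: gspan_mon.
Qed.

Lemma gcoef_gmon c g h : g \in H ->
  gcoef (balg_val (gmon c g)) h = gcoef b (h * g^-1)%g * c.
Proof.
by move=> gH; rewrite gmonE // -scale_galgAr gcoefZ gcoef_baseMr mulrC.
Qed.

Lemma gbalg_sum (X : {set gT}) (a : A) : X \subset H -> gspan X (balg_val a) ->
  a = \sum_(g in X) gmon (gcoef (balg_val a) g) g.
Proof.
move=> sXH aX; have [_ ba _] := balg_valP a; apply: val_inj.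
rewrite -[RHS]/(balg_val _) balg_val_sum -[LHS]/(balg_val a).
under eq_bigr => g gX do rewrite gmonE ?(subsetP sXH) //.
by rewrite -mulr_sumr -galg_sum.
Qed.

Lemma gspan_comp x (a : A) : gring_comp x a ->
  gspan (H :&: set_of_coset (sgval x)) (balg_val a).
Proof.
move=> /gspanP ax; have [/gspanP aH _ _] := balg_valP a.
apply/gspanP => g; rewrite inE negb_and => /orP[]; first exact: aH.
exact: ax.
Qed.

Lemma sum_rcoset (V : nmodType) (F : gT -> V) h : h \in H ->
  \sum_(g in H :&: set_of_coset (sgval (quo h))) F g = \sum_(n in H :&: N) F (n * h)%g.
Proof.
move=> hH; rewrite (reindex_inj (mulIg h)) /=; apply: eq_bigl => n.
have hG := subsetP sHG h hH; rewrite !inE mem_coset_quo groupMr //.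
have [nH|//] := boolP (n \in H); have nG := subsetP sHG n nH.
rewrite groupM //= [_ == quo h]eq_sym quo_eq ?(groupM nG hG) //.
by rewrite -[(_ * (n * h))%g]conjgE memJ_norm // (subsetP (normal_norm nsNG)).
Qed.

Lemma sum_lcoset (V : nmodType) (F : gT -> V) h : N \subset H -> h \in H ->
  \sum_(g in H :&: set_of_coset (sgval (quo h))) F g = \sum_(n in N) F (h * n)%g.
Proof.
move=> sNH hH; rewrite (reindex_inj (mulgI h)) /=; apply: eq_bigl => n.
have hG := subsetP sHG h hH; rewrite !inE mem_coset_quo !groupMl //.
apply/andP/idP => [[nH /andP[nG]]|nN].
  by rewrite [_ == quo h]eq_sym quo_eq ?(groupM hG nG) // mulKg.
have nH := subsetP sNH n nN; have nG := subsetP sHG n nH.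
by rewrite nH nG [_ == quo h]eq_sym quo_eq ?(groupM hG nG) // mulKg.
Qed.

Lemma gbalg_sum_rcoset h (a : A) : h \in H -> gring_comp (quo h) a ->
  a = \sum_(n in H :&: N) gmon (gcoef (balg_val a) (n * h)%g) (n * h)%g.
Proof.
move=> hH ah; rewrite -(sum_rcoset (fun g => gmon (gcoef (balg_val a) g) g)) //.
by apply: gbalg_sum (gspan_comp ah); apply: subsetIl.
Qed.

Lemma gbalg_sum_lcoset h (a : A) : N \subset H -> h \in H -> gring_comp (quo h) a ->
  a = \sum_(n in N) gmon (gcoef (balg_val a) (h * n)%g) (h * n)%g.
Proof.
move=> sNH hH ah; rewrite -(sum_lcoset (fun g => gmon (gcoef (balg_val a) g) g)) //.
by apply: gbalg_sum (gspan_comp ah); apply: subsetIl.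
Qed.

Lemma gbalg_sum1 : 1 = \sum_(n in H :&: N) gmon (gcoef b n) n.
Proof.
have [bHN bb _] := bP; have bH : gspan H b by apply: gspanS bHN; apply: subsetIl.
have v1 : balg_val (1 : A) = b by exact: balg_unitE.
have := @gbalg_sum (H :&: N) 1 (subsetIl _ _); rewrite v1; exact.
Qed.

Lemma gbalg_has_units : (H * N)%g = G -> has_units A.
Proof.
move=> defG x; have [g gG <-] := quo_surj x.
move: (gG); rewrite -{1}defG => /mulsgP[h n hH nN gE].
have hG := subsetP sHG h hH; have nG := subsetP (normal_sub nsNG) n nN.
have -> : quo g = quo h.
  by apply/eqP; rewrite eq_sym quo_eq // gE mulKg.
exists (gmon 1 h), (gmon 1 h^-1%g); split; first exact: gmon_comp.
  by rewrite -quoV //; apply: gmon_comp; rewrite groupV.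
by rewrite gmonM ?groupV // mulgV mulr1 gmon11.
Qed.
End BlockExtensionTheory.

(** Any formula that is a sum over group elements, additive in the coefficients, expands on
    products. Multiplicativity of [gpush] and of both actions on the new bimodule comes from it. *)
Lemma sum_gcoefM (R : comNzRingType) (gT : finGroupType) (X : {group gT})
    (V : nmodType) (phi : R -> gT -> V) (a c : galg R gT) :
    (forall g, g \in X -> {morph phi^~ g : r s / r + s}) ->
    (forall g, g \in X -> phi 0 g = 0) ->
    gspan X a ->
  \sum_(g in X) phi (gcoef (a * c) g) g =
  \sum_(g in X) \sum_(h in X) phi (gcoef a g * gcoef c h) (g * h)%g.
Proof.
move=> phiD phi0 /gspanP aX.
transitivity (\sum_(h in X) \sum_(g in X) phi (gcoef a g * gcoef c (g^-1 * h)%g) h).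
  apply: eq_bigr => h hX; rewrite gcoefM (big_morph _ (phiD h hX) (phi0 h hX)).
  rewrite [RHS]big_mkcond; apply: eq_bigr => g _; case: ifPn => // gX.
  by rewrite aX // mul0r phi0.
rewrite exchange_big; apply: eq_bigr => g gX /=.
rewrite (reindex_inj (mulgI g)); apply: eq_big => [h|h _]; first by rewrite groupMl.
by rewrite mulKg.
Qed.

(** * Transport of the group algebra of N along the embedding *)

Section Push.
Variables (R : comNzRingType) (gT hT : finGroupType) (N : {group gT}).
Variables (iota : {morphism N >-> hT}) (iota_inj : ('injm iota)%g).
Implicit Types (a c : galg R gT).

Lemma gpushE a n : n \in N -> gcoef (gpush N iota a) (iota n) = gcoef a n.
Proof.
move=> nN; rewrite gcoef_sum (bigD1 n) //= gcoefZ gbaseE eqxx mulr1.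
rewrite big1 ?addr0 // => m /andP[mN mn]; rewrite gcoefZ gbaseE.
by rewrite (inj_in_eq (injmP iota_inj)) // eq_sym (negPf mn) mulr0.
Qed.

Lemma gpush_out a y : y \notin (iota @* N)%g -> gcoef (gpush N iota a) y = 0.
Proof.
move=> yN; rewrite gcoef_sum big1 // => n nN; rewrite gcoefZ gbaseE.
case: eqP => [yE|_]; last exact: mulr0.
by rewrite yE mem_morphim in yN.
Qed.

Lemma gpush_span (X : {set gT}) a : X \subset N -> gspan X a ->
  gspan (iota @* X)%g (gpush N iota a).
Proof.
move=> sXN /gspanP aX; apply/gspanP => y yX.
have [/morphimP[n _ nN yE]|/gpush_out->//] := boolP (y \in (iota @* N)%g).
rewrite yE gpushE // aX //; apply: contra yX => nX.
by rewrite yE mem_morphim.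
Qed.

Lemma gpushM a c : gspan N a -> gspan N c ->
  gpush N iota (a * c) = gpush N iota a * gpush N iota c.
Proof.
move=> aN cN; have addphi (g : gT) : {morph (fun r : R => r *: gbase R (iota g)) : r s / r + s}.
  by move=> r s; rewrite scalerDl.
rewrite /gpush (sum_gcoefM (phi := fun r g => r *: gbase R (iota g))) //; last first.
  by move=> g _; rewrite scale0r.
rewrite mulr_suml; apply: eq_bigr => g gN; rewrite mulr_sumr; apply: eq_bigr => h hN.
by rewrite -scale_galgAl -scale_galgAr scalerA gbaseM morphM.
Qed.

Lemma sum_gpush (V : nmodType) (phi : R -> hT -> V) (Y : {set gT}) (X : {set hT}) a :
    (forall y, y \in X -> phi 0 y = 0) -> Y \subset N -> gspan Y a ->
    (iota @* Y \subset X)%g ->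
  \sum_(y in X) phi (gcoef (gpush N iota a) y) y =
  \sum_(n in Y) phi (gcoef a n) (iota n).
Proof.
move=> phi0 sYN aY sYX; have /gspanP pY := gpush_span sYN aY.
rewrite (big_setID (iota @* Y)%g) /= [X in _ + X]big1 ?addr0 => [|y /setDP[yX yY]].
  rewrite (setIidPr sYX) morphimEsub // big_imset /=.
    by apply: eq_bigr => n nY; rewrite gpushE // (subsetP sYN).
  by apply: sub_in2 (injmP iota_inj) => n; apply: (subsetP sYN).
by rewrite pY // phi0.
Qed.
End Push.

(** * Pairs acting in the same way on N *)

Section Pullback.
Variables (gT hT : finGroupType) (G N : {group gT}) (Gh : {group hT}).
Variables (iota : {morphism N >-> hT}) (iota_inj : ('injm iota)%g).
Hypothesis nsNG : (N <| G)%g.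
Implicit Types (p q : gT * hT) (n c : gT).

(* The pairs of elements of G and Gh that act in the same way on N. *)
Definition pullback_set : {set gT * hT} :=
  [set p | [&& p.1 \in G, p.2 \in Gh
    & [forall n in N, iota (n ^ p.1)%g == (iota n ^ p.2)%g]]].

Lemma pullbackP p : reflect
  [/\ p.1 \in G, p.2 \in Gh & forall n, n \in N -> iota (n ^ p.1)%g = (iota n ^ p.2)%g]
  (p \in pullback_set).
Proof.
rewrite inE; apply: (iffP and3P) => -[pG pGh pN]; split=> //.
  by move=> n nN; apply/eqP; move/forall_inP: pN; apply.
by apply/forall_inP => n nN; apply/eqP; apply: pN.
Qed.

Lemma memN_conj n g : g \in G -> (n ^ g \in N)%g = (n \in N).
Proof. by move=> gG; rewrite memJ_norm // (subsetP (normal_norm nsNG)). Qed.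

Fact pullback_group_set : group_set pullback_set.
Proof.
apply/group_setP; split=> [|p q /pullbackP[pG pGh pN] /pullbackP[qG qGh qN]].
  by apply/pullbackP; split=> [||n _]; rewrite ?group1 ?conjg1.
apply/pullbackP; split=> [||n nN]; rewrite ?groupM //.
by rewrite !conjgM qN ?pN ?memN_conj.
Qed.
Canonical pullback := Group pullback_group_set.

Definition diag n : gT * hT := (n, iota n).
Definition cpair c : gT * hT := (c, 1%g).

Lemma diag_pullback n : n \in N -> (iota @* N)%g \subset Gh -> diag n \in pullback.
Proof.
move=> nN sNh; have nG := subsetP (normal_sub nsNG) n nN.
apply/pullbackP; split=> [||m mN] //=; first by rewrite (subsetP sNh) ?mem_morphim.
by rewrite morphJ.
Qed.

Lemma diagM n m : n \in N -> m \in N -> diag (n * m)%g = (diag n * diag m)%g.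
Proof. by move=> nN mN; rewrite /diag morphM. Qed.

Lemma diagV n : n \in N -> diag n^-1%g = (diag n)^-1%g.
Proof. by move=> nN; rewrite /diag morphV. Qed.

Lemma diagJ n p : n \in N -> p \in pullback -> (diag n ^ p)%g = diag (n ^ p.1)%g.
Proof. by move=> nN /pullbackP[_ _ pN]; rewrite /diag pN. Qed.

Lemma cpair_pullback c : c \in 'C_G(N)%g -> cpair c \in pullback.
Proof.
move=> /setIP[cG /centP cN]; apply/pullbackP; split=> //= n nN.
by rewrite conjg1 conjgE -cN // mulKg.
Qed.

Lemma centG_conj c g : g \in G -> c \in 'C_G(N)%g -> (c ^ g \in 'C_G(N))%g.
Proof.
move=> gG cC; rewrite memJ_norm //; apply: (subsetP _ g gG).
by rewrite normsI ?normG // (subset_trans (normal_norm nsNG)) // cent_norm.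
Qed.

Lemma cpairJ c p : (cpair c ^ p)%g = cpair (c ^ p.1)%g.
Proof.
apply: injective_projections; rewrite //=.
by rewrite -[LHS]/(1 ^ p.2)%g conj1g.
Qed.

(** The first coordinate of p^-1 q acts on N as its second coordinate 1 does, hence centralizes N,
    as [iota] is injective. *)
Lemma pullback_fiber p q : p \in pullback -> q \in pullback -> p.2 = q.2 ->
  exists2 c, c \in 'C_G(N)%g & q = (p * cpair c)%g.
Proof.
move=> pP qP e; exists (p.1^-1 * q.1)%g; last first.
  by apply: injective_projections => /=; rewrite ?mulKVg // e mulg1.
have /pullbackP[tG _ tN] : (p^-1 * q)%g \in pullback by rewrite groupM ?groupV.
apply/setIP; split=> //; apply/centP => n nN; apply: commute_sym.
apply/commgP/conjg_fixP; apply: (injmP iota_inj) => //; first by rewrite memN_conj.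
by rewrite tN //= e mulVg conjg1.
Qed.

Lemma pullback_diag p : p \in pullback -> p.2 \in (iota @* N)%g -> (iota @* N)%g \subset Gh ->
  exists n c, [/\ n \in N, c \in 'C_G(N)%g & p = (diag n * cpair c)%g].
Proof.
move=> pP /morphimP[n nN _ pE] sNh.
by have [c cC ->] := pullback_fiber (diag_pullback nN sNh) pP (esym pE); exists n, c.
Qed.

End Pullback.

Section ConjugationIdentities.
Variable gT : finGroupType.
Implicit Types x h t : gT.

Lemma mul_conj_cancel x h t : (x * h * (t * h^-1 ^ t * t^-1) = x)%g.
Proof. by rewrite conjgE !mulgA !mulgK. Qed.

Lemma conj_mul_cancel x h : (h^-1 ^ x^-1 * (x * h) = x)%g.
Proof. by rewrite conjgE invgK !mulgA !mulgKV. Qed.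

Lemma conjV_mul x h : (h ^ x^-1 * x = x * h)%g.
Proof. by rewrite conjgE invgK !mulgA mulgKV. Qed.
End ConjugationIdentities.

(** * The bimodule over the new algebras *)

Section Butterfly.
Variables (R : comNzRingType) (gT hT : finGroupType) (G N H : {group gT}).
Variables (Gh Hh : {group hT}) (iota : {morphism N >-> hT}).
Hypotheses (nsNG : (N <| G)%g) (sHG : H \subset G) (sCH : 'C_G(N)%g \subset H).
Hypothesis iota_inj : ('injm iota)%g.
Local Notation Nh := (iota @* N)%G.
Hypotheses (nsNhGh : (Nh <| Gh)%g) (sHhGh : Hh \subset Gh).
Variables b b' : galg R gT.
Hypotheses (bP : invariant_idempotent N G b) (b'P : invariant_idempotent N H b').
Local Notation bh := (gpush N iota b).
Local Notation bh' := (gpush N iota b').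
Hypotheses (bhP : invariant_idempotent Nh Gh bh).
Hypotheses (bh'P : invariant_idempotent Nh Hh bh').
Local Notation Gamma := (pullback Gh iota nsNG).
Local Notation diag := (diag iota).
Local Notation cpair := (@cpair gT hT).
Hypothesis Gamma_surj : forall y, y \in Gh -> exists g, (g, y) \in Gamma.
Hypothesis GammaH : forall p, p \in Gamma -> (p.2 \in Hh) = (p.1 \in H).
Variable M : gbimod (gbalg G N G b) (gbalg G N H b').
Hypotheses (gM : graded_bimodule M) (cM : bimodule_over_centralizer M).
Implicit Types (p q : gT * hT) (m : M) (c d : R) (g h n : gT).

Let sNG := normal_sub nsNG.
Let sNhGh := normal_sub nsNhGh.
Let A1 := balg_comp1 nsNG (subxx G) bP.
Let A'1 := balg_comp1 nsNG sHG b'P.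

(* Sealed: failing conversions would otherwise unfold the actions at length.  *)
Fact lmon_sig : {f : R -> gT -> M -> M | forall c g m, f c g m = lact (gmon G N G b c g) m}.
Proof. by exists (fun c g m => lact (gmon G N G b c g) m). Qed.
Definition lmon := sval lmon_sig.
Lemma lmonE c g m : lmon c g m = lact (gmon G N G b c g) m.
Proof. exact: (svalP lmon_sig). Qed.

Fact rmon_sig : {f : M -> R -> gT -> M | forall m c h, f m c h = ract m (gmon G N H b' c h)}.
Proof. by exists (fun m c h => ract m (gmon G N H b' c h)). Qed.
Definition rmon := sval rmon_sig.
Lemma rmonE m c h : rmon m c h = ract m (gmon G N H b' c h).
Proof. exact: (svalP rmon_sig). Qed.

Lemma lmonM c d m g h : g \in G -> h \in G ->
  lmon c g (lmon d h m) = lmon (c * d) (g * h)%g m.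
Proof. by move=> gG hG; rewrite !lmonE -(gmonM G bP c d gG hG) lactA. Qed.

Lemma rmonM m c d g h : g \in H -> h \in H ->
  rmon (rmon m c g) d h = rmon m (c * d) (g * h)%g.
Proof. by move=> gG hG; rewrite !rmonE -(gmonM G b'P c d gG hG) ractA. Qed.

Lemma lmon11 m : lmon 1 1%g m = m.
Proof. by rewrite lmonE (gmon11 G bP) lact1. Qed.

Lemma rmon11 m : rmon m 1 1%g = m.
Proof. by rewrite rmonE (gmon11 G b'P) ract1. Qed.

Lemma lrmon c g m d h : rmon (lmon c g m) d h = lmon c g (rmon m d h).
Proof. by rewrite !rmonE !lmonE lractA. Qed.

Lemma lmonD c g m1 m2 : lmon c g (m1 + m2) = lmon c g m1 + lmon c g m2.
Proof. by rewrite !lmonE lactDr. Qed.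

Lemma rmonD c g m1 m2 : rmon (m1 + m2) c g = rmon m1 c g + rmon m2 c g.
Proof. by rewrite !rmonE ractDl. Qed.

Lemma lmonDl c d g m : g \in G -> lmon (c + d) g m = lmon c g m + lmon d g m.
Proof. by move=> gG; rewrite !lmonE (gmonD G bP) // lactDl. Qed.

Lemma rmonDl c d g m : g \in H -> rmon m (c + d) g = rmon m c g + rmon m d g.
Proof. by move=> gG; rewrite !rmonE (gmonD G b'P) // ractDr. Qed.

Lemma lmon0 c g : lmon c g 0 = 0. Proof. by rewrite lmonE lact0r. Qed.
Lemma rmon0 c g : rmon 0 c g = 0. Proof. by rewrite rmonE ract0l. Qed.

Lemma lmon_comp c g x m : g \in G -> gcomp x m -> gcomp (quo G N g * x)%g (lmon c g m).
Proof.
by move=> gG mx; rewrite lmonE; apply: (lact_comp A'1 gM) mx; apply: gmon_comp.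
Qed.

Lemma rmon_comp c g x m : g \in H -> gcomp x m -> gcomp (x * quo G N g)%g (rmon m c g).
Proof.
by move=> gG mx; rewrite rmonE; apply: (ract_comp A1 gM) mx _; apply: gmon_comp.
Qed.

(** The hypothesis that M is over C enters the construction through this identity. For h = 1 it says
    that scalars act alike on both sides. *)
Lemma rmon_cent c g h m : g \in G -> h \in 'C_G(N)%g -> gcomp (quo G N g) m ->
  rmon m c h = lmon c (g * h * g^-1)%g m.
Proof.
move=> gG hC mg; rewrite rmonE (cM (g := g) _ mg); last 2 first.
- by rewrite (mem_coset_quo nsNG) gG eqxx.
- by apply/gspanZ/gspan_base.
rewrite lmonE /gmon /gconj -scale_galgAr gbaseM -scale_galgAl.
by rewrite gbaseM.
Qed.

Lemma lmon_sum1 m : \sum_(n in N) lmon (gcoef b n) n m = m.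
Proof.
rewrite -[RHS]lact1 (gbalg_sum1 G bP) lact_suml (setIidPr sNG).
by apply: eq_bigr => n _; rewrite lmonE.
Qed.

Lemma rmon_sum1 m : \sum_(n in H :&: N) rmon m (gcoef b' n) n = m.
Proof.
rewrite -[RHS]ract1 (gbalg_sum1 G b'P) ract_sumr.
by apply: eq_bigr => n _; rewrite rmonE.
Qed.

(** A vector y g^-1 m with m in M_g can be rewritten with (g n, y n), keeping m, or with (g c, y),
    replacing m by (g c g^-1) m = m c; the last two conditions record this. One value on each coset
    of Nh therefore determines F ([hat_eq_fiber]). *)
Definition is_hat (F : {ffun gT * hT -> M}) : Prop :=
  [/\ forall p, p \notin Gamma -> F p = 0,
      forall p, p \in Gamma -> gcomp (quo G N p.1) (F p),
      forall p n, p \in Gamma -> n \in N -> F (p * diag n)%g = F p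
    & forall p h, p \in Gamma -> h \in 'C_G(N)%g -> F (p * cpair h)%g = rmon (F p) 1 h].

Definition in_hat : pred {ffun gT * hT -> M} := fun F => `[< is_hat F >].

(* [F (g, y)] stands for the element [y g^-1 F (g, y)] of the component of the *)
(* coset of y; this does not depend on g.                                     *)
Record hat : Type := Hat { hat_fun :> {ffun gT * hT -> M}; _ : in_hat hat_fun }.

HB.instance Definition _ := [isSub for hat_fun].
HB.instance Definition _ := [Choice of hat by <:].

Fact in_hat_zmod : zmod_closed in_hat.
Proof.
have sgM x : is_subgroup (@gcomp _ _ _ M x) by have [[+ _ _] _] := gM; apply.
split=> [|F F'].
  apply/asboolP; split=> [p _|p _|p n _ _|p h _ _]; rewrite !ffunE ?rmon0 //.
  exact: (sgM _).1.
move=> /asboolP[F1 F2 F3 F4] /asboolP[F'1 F'2 F'3 F'4].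
have subE p : (F - F') p = F p - F' p by rewrite !ffunE.
apply/asboolP; split=> [p pG|p pG|p n pG nN|p h pG hC]; rewrite !subE.
- by rewrite F1 // F'1 // subrr.
- by apply: (sgM _).2; [exact: F2|exact: F'2].
- by rewrite F3 // F'3.
- by rewrite F4 // F'4 //  !rmonE ractBl.
Qed.
HB.instance Definition _ :=
  GRing.isZmodClosed.Build {ffun gT * hT -> M} in_hat in_hat_zmod.
HB.instance Definition _ := [SubChoice_isSubZmodule of hat by <:].

Lemma hatP (F : hat) : is_hat F. Proof. by case: F => F /= /asboolP. Qed.

Lemma hat_ext (F F' : hat) : (forall p, p \in Gamma -> F p = F' p) -> F = F'.
Proof.
move=> e; apply/val_inj/ffunP => p; have [pG|pG] := boolP (p \in Gamma); first exact: e.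
by have [-> //] := hatP F; have [-> //] := hatP F'.
Qed.

Lemma hatD (F F' : hat) p : (F + F') p = F p + F' p.
Proof. by rewrite -[LHS]/((val F + val F') p) ffunE. Qed.

Lemma hatB (F F' : hat) p : (F - F') p = F p - F' p.
Proof. by rewrite -[LHS]/((val F - val F') p) !ffunE. Qed.

Lemma hat0 p : (0 : hat) p = 0.
Proof. by rewrite -[LHS]/((0 : {ffun gT * hT -> M}) p) ffunE. Qed.

Lemma hat_sum I (s : seq I) P (F : I -> hat) p :
  (\sum_(i <- s | P i) F i) p = \sum_(i <- s | P i) F i p.
Proof. by apply: (big_morph (fun F : hat => F p)) => [F1 F2|]; rewrite ?hatD ?hat0. Qed.

Lemma hat_comp (F : hat) p : p \in Gamma -> gcomp (quo G N p.1) (F p).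
Proof. by have [_ + _ _] := hatP F; apply. Qed.
Lemma hat_diag (F : hat) p n : p \in Gamma -> n \in N -> F (p * diag n)%g = F p.
Proof. by have [_ _ + _] := hatP F; apply. Qed.
Lemma hat_cpair (F : hat) p h :
  p \in Gamma -> h \in 'C_G(N)%g -> F (p * cpair h)%g = rmon (F p) 1 h.
Proof. by have [_ _ _ +] := hatP F; apply. Qed.

Lemma hat_insubd (F : {ffun gT * hT -> M}) q : is_hat F -> (insubd (0 : hat) F) q = F q.
Proof.
move=> FP; have e : val (insubd (0 : hat) F) = F by apply: insubdK; apply/asboolP.
by rewrite -{2}e.
Qed.

Lemma GammaP p : p \in Gamma -> p.1 \in G /\ p.2 \in Gh.
Proof. by case/pullbackP. Qed.

Lemma diag_Gamma n : n \in N -> diag n \in Gamma.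
Proof. by move=> nN; apply: diag_pullback. Qed.

Lemma cpair_Gamma h : h \in 'C_G(N)%g -> cpair h \in Gamma.
Proof. exact: cpair_pullback. Qed.

Lemma hat_diagl (F : hat) p n : p \in Gamma -> n \in N -> F (diag n * p)%g = F p.
Proof.
move=> pG nN; rewrite conjgC (diagJ nN pG) hat_diag // (memN_conj nsNG) //.
by have [] := GammaP pG.
Qed.

(** * Actions of pairs on functions *)

Fact is_hat_lmul c p (F : hat) : p \in Gamma ->
  is_hat [ffun q => lmon c p.1 (F (p^-1 * q)%g)].
Proof.
move=> pG; have [p1G _] := GammaP pG.
have [F1 _ _ _] := hatP F.
split=> [q qG|q qG|q n qG nN|q h qG hC]; rewrite !ffunE.
- by rewrite F1 ?lmon0 // groupMl ?groupV.
- have [q1G _] := GammaP qG.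
  have := lmon_comp c p1G (hat_comp F (groupM (groupVr pG) qG)).
  by rewrite -quoM ?groupM ?groupV //= mulKVg.
- by rewrite mulgA hat_diag // groupM ?groupV.
- by rewrite mulgA hat_cpair ?groupM ?groupV // lrmon.
Qed.

Fact is_hat_rmul c p (F : hat) : p \in Gamma -> p.1 \in H ->
  is_hat [ffun q => rmon (F (q * p^-1)%g) c p.1].
Proof.
move=> pG pH; have [p1G _] := GammaP pG.
have [F1 _ _ _] := hatP F; have pVG : (p^-1)%g \in Gamma by rewrite groupV.
split=> [q qG|q qG|q n qG nN|q h qG hC]; rewrite !ffunE.
- by rewrite F1 ?rmon0 // groupMr ?groupV.
- have [q1G _] := GammaP qG.
  have := rmon_comp c pH (hat_comp F (groupM qG pVG)).
  by rewrite -quoM ?groupM ?groupV //= mulgKV.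
(* Both subgroups, diagonal N and C_G(N), are normalized by Gamma, so p^-1 passes them at the price
   of a conjugation. *)
- have -> : (q * diag n * p^-1 = q * p^-1 * diag (n ^ (p^-1).1))%g.
    by rewrite -(diagJ nN pVG) -!mulgA -conjgC.
  by rewrite (hat_diag F (groupM qG pVG)) // (memN_conj nsNG) ?groupV.
- have hJC : (h ^ (p^-1).1)%g \in 'C_G(N)%g by apply: (centG_conj nsNG); rewrite ?groupV.
  have -> : (q * cpair h * p^-1 = q * p^-1 * cpair (h ^ (p^-1).1))%g.
    by rewrite -cpairJ -!mulgA -conjgC.
  rewrite (hat_cpair F (groupM qG pVG) hJC).
  move: (F _) => m; rewrite -[(p^-1%g).1]/(p.1^-1%g) in hJC *.
  rewrite (rmonM m 1 c (subsetP sCH _ hJC) pH).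
  by rewrite (rmonM m c 1 pH (subsetP sCH _ hC)) mulr1 mul1r conjV_mul.
Qed.

(** An arbitrary lift of y to Gamma. The default 1 is harmless, since lifts exist for all y in
    Gh. *)
Definition sect y : gT * hT := (odflt 1%g [pick g | (g, y) \in Gamma], y).

Lemma sect_Gamma y : y \in Gh -> sect y \in Gamma.
Proof.
move=> yGh; rewrite /sect; case: pickP => //= no; have [g gy] := Gamma_surj yGh.
by have := no g; rewrite /= gy.
Qed.

Lemma sectH y : y \in Hh -> (sect y).1 \in H.
Proof. by move=> yH; rewrite -(GammaH (sect_Gamma (subsetP sHhGh y yH))). Qed.

(** Replacing p by (p.1 h, p.2) multiplies the value of F on the right by a conjugate of h^-1. By
    [rmon_cent] this is left multiplication by h^-1, which cancels the h in p.1 h. *)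
Lemma lmon_indep c p p' (F : hat) q : p \in Gamma -> p' \in Gamma -> p.2 = p'.2 ->
  q \in Gamma -> lmon c p'.1 (F (p'^-1 * q)%g) = lmon c p.1 (F (p^-1 * q)%g).
Proof.
move=> pG p'G e qG; have [h hC p'E] := pullback_fiber iota_inj pG p'G e.
have [p1G _] := GammaP pG; have [p'1G _] := GammaP p'G.
have [t tE] : exists t, t = (p^-1 * q)%g by exists (p^-1 * q)%g.
have tG : t \in Gamma by rewrite tE groupM ?groupV.
have [t1G _] := GammaP tG; have hVG : (h^-1)%g \in 'C_G(N)%g by rewrite groupV.
have hVC : (h^-1 ^ t.1 \in 'C_G(N))%g by apply: (centG_conj nsNG).
have -> : (p'^-1 * q = t * cpair (h^-1 ^ t.1))%g.
  rewrite p'E invMg -mulgA -tE -cpairJ -conjgC; congr (_ * _)%g.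
  by apply: injective_projections; rewrite //= invg1.
rewrite -tE (hat_cpair F tG hVC) (rmon_cent _ t1G hVC (hat_comp F tG)).
have kG := groupM (groupM t1G (subsetP (subsetIl _ _) _ hVC)) (groupVr t1G).
rewrite (lmonM c 1 (F t) p'1G kG) mulr1.
have -> : p'.1 = (p.1 * h)%g by rewrite p'E.
by rewrite mul_conj_cancel.
Qed.

(** Here the cancellation takes place inside H: equivariance of F produces h^-1 conjugated by
    p.1^-1, and multiplying it by p.1 h gives p.1. *)
Lemma rmon_indep c p p' (F : hat) q : p \in Gamma -> p' \in Gamma -> p.2 = p'.2 ->
  p.1 \in H -> q \in Gamma -> rmon (F (q * p'^-1)%g) c p'.1 = rmon (F (q * p^-1)%g) c p.1.
Proof.
move=> pG p'G e pH qG; have [h hC p'E] := pullback_fiber iota_inj pG p'G e.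
have hH := subsetP sCH h hC.
have [p1G _] := GammaP pG; have pVG : (p^-1)%g \in Gamma by rewrite groupV.
have hVC : (h^-1 ^ (p^-1).1 \in 'C_G(N))%g by rewrite (centG_conj nsNG) ?groupV.
have -> : (q * p'^-1 = q * p^-1 * cpair (h^-1 ^ (p^-1).1))%g.
  rewrite p'E invMg -cpairJ -!mulgA -conjgC; congr (_ * (_ * _))%g.
  by apply: injective_projections; rewrite //= invg1.
rewrite (hat_cpair F (groupM qG pVG) hVC).
have p'H : p'.1 \in H by rewrite -(GammaH p'G) -e GammaH.
have p'1E : p'.1 = (p.1 * h)%g by rewrite p'E.
move: (F _) => m; rewrite -[(p^-1%g).1]/(p.1^-1%g) in hVC *.
by rewrite (rmonM m 1 c (subsetP sCH _ hVC) p'H) mul1r p'1E conj_mul_cancel.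
Qed.

(** For p = (g', y'), the vector y' (y g^-1 m) equals (y' y)(g' g)^-1 (g' m): left multiplication by
    y' translates the argument by p and applies g' to the values. [hr_sig] is the same on the right,
    where only g' in H can act. *)
Fact hl_sig : {f : R -> gT * hT -> hat -> hat |
  forall c p F q, p \in Gamma -> f c p F q = lmon c p.1 (F (p^-1 * q)%g)}.
Proof.
exists (fun c p F => insubd 0 [ffun q => lmon c p.1 (F (p^-1 * q)%g)]) => c p F q pG.
by rewrite hat_insubd ?ffunE //; apply: is_hat_lmul.
Qed.
Definition hl := sval hl_sig.
Lemma hlE c p (F : hat) q : p \in Gamma -> hl c p F q = lmon c p.1 (F (p^-1 * q)%g).
Proof. exact: (svalP hl_sig). Qed.

Fact hr_sig : {f : hat -> R -> gT * hT -> hat |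
  forall F c p q, p \in Gamma -> p.1 \in H -> f F c p q = rmon (F (q * p^-1)%g) c p.1}.
Proof.
exists (fun F c p => insubd 0 [ffun q => rmon (F (q * p^-1)%g) c p.1]) => F c p q pG pH.
by rewrite hat_insubd ?ffunE //; apply: is_hat_rmul.
Qed.
Definition hr := sval hr_sig.
Lemma hrE (F : hat) c p q : p \in Gamma -> p.1 \in H -> hr F c p q = rmon (F (q * p^-1)%g) c p.1.
Proof. exact: (svalP hr_sig). Qed.

Lemma hl_indep c p p' F : p \in Gamma -> p' \in Gamma -> p.2 = p'.2 -> hl c p F = hl c p' F.
Proof.
by move=> pG p'G e; apply: hat_ext => q qG; rewrite (hlE c F q pG) (hlE c F q p'G);
  rewrite -(lmon_indep c F pG p'G e qG).
Qed.

Lemma hr_indep c p p' F : p \in Gamma -> p' \in Gamma -> p.2 = p'.2 -> p.1 \in H ->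
  hr F c p = hr F c p'.
Proof.
move=> pG p'G e pH; have p'H : p'.1 \in H by rewrite -(GammaH p'G) -e GammaH.
by apply: hat_ext => q qG; rewrite (hrE F c q pG pH) (hrE F c q p'G p'H);
  rewrite -(rmon_indep c F pG p'G e pH qG).
Qed.

Lemma hlD c p F F' : p \in Gamma -> hl c p (F + F') = hl c p F + hl c p F'.
Proof. by move=> pG; apply: hat_ext => q _; rewrite hatD !hlE // hatD lmonD. Qed.

Lemma hrD c p F F' : p \in Gamma -> p.1 \in H -> hr (F + F') c p = hr F c p + hr F' c p.
Proof. by move=> pG pH; apply: hat_ext => q _; rewrite hatD !hrE // hatD rmonD. Qed.

Lemma hlDl c d p F : p \in Gamma -> hl (c + d) p F = hl c p F + hl d p F.
Proof.
move=> pG; have [p1G _] := GammaP pG; apply: hat_ext => q _.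
by rewrite hatD !hlE // (lmonDl c d _ p1G).
Qed.

Lemma hrDl c d p F : p \in Gamma -> p.1 \in H -> hr F (c + d) p = hr F c p + hr F d p.
Proof. by move=> pG pH; apply: hat_ext => q _; rewrite hatD !hrE // (rmonDl c d _ pH). Qed.

Lemma hl0l p F : p \in Gamma -> hl 0 p F = 0.
Proof. by move=> pG; apply: (addIr (hl 0 p F)); rewrite -hlDl // !add0r. Qed.

Lemma hr0l p F : p \in Gamma -> p.1 \in H -> hr F 0 p = 0.
Proof. by move=> pG pH; apply: (addIr (hr F 0 p)); rewrite -hrDl // !add0r. Qed.

Lemma hl0 c p : p \in Gamma -> hl c p 0 = 0.
Proof. by move=> pG; apply: (addIr (hl c p 0)); rewrite -hlD // !add0r. Qed.

Lemma hr0 c p : p \in Gamma -> p.1 \in H -> hr 0 c p = 0.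
Proof. by move=> pG pH; apply: (addIr (hr 0 c p)); rewrite -hrD // !add0r. Qed.

Lemma hl_sum c p I (s : seq I) P (F : I -> hat) : p \in Gamma ->
  hl c p (\sum_(i <- s | P i) F i) = \sum_(i <- s | P i) hl c p (F i).
Proof.
by move=> pG; apply: (big_morph (hl c p)) => [F1 F2|]; [apply: hlD|apply: hl0].
Qed.

Lemma hr_sum c p I (s : seq I) P (F : I -> hat) : p \in Gamma -> p.1 \in H ->
  hr (\sum_(i <- s | P i) F i) c p = \sum_(i <- s | P i) hr (F i) c p.
Proof.
by move=> pG pH; apply: (big_morph (fun F => hr F c p)) => [F1 F2|];
  [apply: hrD|apply: hr0].
Qed.

Lemma hlM c d p p' F : p \in Gamma -> p' \in Gamma ->
  hl c p (hl d p' F) = hl (c * d) (p * p')%g F.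
Proof.
move=> pG p'G; have [p1G _] := GammaP pG; have [p'1G _] := GammaP p'G.
have ppG := groupM pG p'G; apply: hat_ext => q _.
rewrite (hlE c _ q pG) (hlE d F _ p'G) (hlE _ F q ppG).
have -> : ((p * p')^-1 * q = p'^-1 * (p^-1 * q))%g by rewrite invMg mulgA.
exact: (lmonM c d (F _) p1G p'1G).
Qed.

Lemma hrM c d p p' F : p \in Gamma -> p' \in Gamma -> p.1 \in H -> p'.1 \in H ->
  hr (hr F c p) d p' = hr F (c * d) (p * p')%g.
Proof.
move=> pG p'G pH p'H; have ppH : (p * p')%g.1 \in H by apply: (groupM pH p'H).
have ppG := groupM pG p'G.
apply: hat_ext => q _; rewrite (hrE _ d q p'G p'H) (hrE F c _ pG pH) (hrE F _ q ppG ppH).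
have -> : (q * (p * p')^-1 = q * p'^-1 * p^-1)%g by rewrite invMg mulgA.
exact: (rmonM (F _) c d pH p'H).
Qed.

Lemma hlr c d p p' F : p \in Gamma -> p' \in Gamma -> p'.1 \in H ->
  hr (hl c p F) d p' = hl c p (hr F d p').
Proof.
move=> pG p'G p'H; apply: hat_ext => q _.
rewrite (hrE _ d q p'G p'H) (hlE c F _ pG) (hlE c _ q pG) (hrE F d _ p'G p'H).
by rewrite mulgA; apply: lrmon.
Qed.

Definition hlact (a : galg R hT) (F : hat) : hat := \sum_(y in Gh) hl (gcoef a y) (sect y) F.
Definition hract (F : hat) (a : galg R hT) : hat := \sum_(y in Hh) hr F (gcoef a y) (sect y).

Lemma hlactDr a F F' : hlact a (F + F') = hlact a F + hlact a F'.
Proof. by rewrite -big_split; apply: eq_bigr => y yG; rewrite hlD ?sect_Gamma. Qed.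

Lemma hlactDl a a' F : hlact (a + a') F = hlact a F + hlact a' F.
Proof.
by rewrite -big_split; apply: eq_bigr => y yG; rewrite gaddE hlDl ?sect_Gamma.
Qed.

Lemma hractDl F F' a : hract (F + F') a = hract F a + hract F' a.
Proof.
rewrite -big_split; apply: eq_bigr => y yH.
by rewrite hrD ?sectH // sect_Gamma // (subsetP sHhGh).
Qed.

Lemma hractDr F a a' : hract F (a + a') = hract F a + hract F a'.
Proof.
rewrite -big_split; apply: eq_bigr => y yH.
by rewrite gaddE hrDl ?sectH // sect_Gamma // (subsetP sHhGh).
Qed.

Lemma sectHG y : y \in Hh -> sect y \in Gamma.
Proof. by move=> yH; apply: sect_Gamma; apply: (subsetP sHhGh). Qed.

Lemma hlactA a a' F : gspan Gh a -> hlact (a * a') F = hlact a (hlact a' F).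
Proof.
move=> aG; rewrite /hlact (sum_gcoefM (phi := fun c y => hl c (sect y) F)) //; first last.
- by move=> y yG; apply: hl0l; apply: sect_Gamma.
- by move=> y yG c d; apply: hlDl; apply: sect_Gamma.
apply: eq_bigr => y yG; rewrite (hl_sum _ _ _ _ (sect_Gamma yG)).
apply: eq_bigr => z zG; have yS := sect_Gamma yG; have zS := sect_Gamma zG.
by rewrite (hlM _ _ _ yS zS); apply: hl_indep => //; rewrite ?sect_Gamma ?groupM.
Qed.

Lemma hractA F a a' : gspan Hh a -> hract F (a * a') = hract (hract F a) a'.
Proof.
move=> aG; rewrite /hract (sum_gcoefM (phi := fun c y => hr F c (sect y))) //; first last.
- by move=> y yG; apply: hr0l; rewrite ?sectH ?sectHG.
- by move=> y yG c d; apply: hrDl; rewrite ?sectH ?sectHG.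
rewrite exchange_big; apply: eq_bigr => z zH; have zS := sectHG zH; have zSH := sectH zH.
rewrite (hr_sum _ _ _ _ zS zSH).
apply: eq_bigr => y yH; have yS := sectHG yH; have ySH := sectH yH.
rewrite (hrM _ _ _ yS zS ySH zSH); have yzH := groupM yH zH.
by apply: hr_indep => //; rewrite ?sectHG ?sectH ?(groupM yS zS).
Qed.

Lemma diag_fiber n : n \in N -> diag n \in Gamma /\ sect (iota n) \in Gamma.
Proof.
by move=> nN; split; [exact: diag_Gamma|rewrite sect_Gamma // (subsetP sNhGh) ?mem_morphim].
Qed.

Lemma diagV_mul n q : n \in N -> ((diag n)^-1 * q = diag n^-1 * q)%g.
Proof. by move=> nN; rewrite diagV. Qed.

(** The lift of [iota] n may be taken to be [diag n], whose translation F does not see; what remains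
    is the action of b on the values of F. *)
Lemma hlact1 F : hlact bh F = F.
Proof.
have bN : gspan N b by have [bGN _ _] := bP; rewrite -(setIidPr sNG).
rewrite /hlact (sum_gpush iota_inj (phi := fun c y => hl c (sect y) F) (Y := N)) //; first last.
  by move=> y yG; apply: hl0l; apply: sect_Gamma.
apply: hat_ext => q qG; rewrite hat_sum -[RHS]lmon_sum1; apply: eq_bigr => n nN.
have [dG sG] := diag_fiber nN; rewrite (hl_indep _ _ sG dG) // hlE //.
by rewrite diagV_mul // hat_diagl // groupV.
Qed.

Lemma hract1 F : hract F bh' = F.
Proof.
have [bHN _ _] := b'P; have sHNN := subsetIr H N.
rewrite /hract (sum_gpush iota_inj (phi := fun c y => hr F c (sect y))
  (Y := H :&: N)) //; first last.
- apply/subsetP => y /morphimP[n nN nHN ->].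
  by rewrite (GammaH (diag_Gamma nN)); case/setIP: nHN.
- by move=> y yG; apply: hr0l; rewrite ?sectH ?sectHG.
apply: hat_ext => q qG; rewrite hat_sum -[RHS]rmon_sum1; apply: eq_bigr => n nHN.
have [nH nN] := setIP nHN; have [dG sG] := diag_fiber nN.
rewrite -(hr_indep _ _ dG sG) // hrE //.
by rewrite -diagV // hat_diag // groupV.
Qed.

Lemma hlract a F a' : hract (hlact a F) a' = hlact a (hract F a').
Proof.
rewrite /hract /hlact.
transitivity (\sum_(z in Hh) \sum_(y in Gh)
    hl (gcoef a y) (sect y) (hr F (gcoef a' z) (sect z))).
  apply: eq_bigr => z zH; have zS := sectHG zH; have zSH := sectH zH.
  rewrite (hr_sum _ _ _ _ zS zSH).
  by apply: eq_bigr => y yG; rewrite hlr // sect_Gamma.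
rewrite exchange_big; apply: eq_bigr => y yG; have yS := sect_Gamma yG.
by rewrite (hl_sum _ _ _ _ yS).
Qed.

Local Notation Ah := (gbalg Gh Nh Gh bh).
Local Notation Ah' := (gbalg Gh Nh Hh bh').

Fact hat_bimodule : is_bimodule (fun (a : Ah) F => hlact (balg_val a) F)
                                (fun F (a : Ah') => hract F (balg_val a)).
Proof.
split; [split|split|].
- by move=> a; apply: hlactDr.
- by move=> a a' F; apply: hlactDl.
- by move=> a a' F; have [aG _ _] := balg_valP bhP a; apply: hlactA.
- move=> F; have -> : balg_val (1 : Ah) = bh; last exact: hlact1.
  by have [bN bb _] := bhP; apply: balg_unitE => //; apply: gspanS bN; apply: subsetIl.
- by move=> F F' a; apply: hractDl.
- by move=> F a a'; apply: hractDr.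
- by move=> F a a'; have [aG _ _] := balg_valP bh'P a; apply: hractA.
- move=> F; have -> : balg_val (1 : Ah') = bh'; last exact: hract1.
  by have [bN bb _] := bh'P; apply: balg_unitE => //; apply: gspanS bN; apply: subsetIl.
- by move=> a F a'; apply: hlract.
Qed.

(** * The grading and the condition over the centralizer *)

Definition hat_comp_at (x : subg_of (Gh / Nh)) (F : hat) : Prop :=
  forall q, q \in Gamma -> quo Gh Nh q.2 != x -> F q = 0.

Definition hat_bimod : gbimod Ah Ah' :=
  @GBimod _ Ah Ah' hat _ _ hat_comp_at hat_bimodule.

Lemma hlactE a F q :
  hlact a F q = \sum_(y in Gh) lmon (gcoef a y) (sect y).1 (F ((sect y)^-1 * q)%g).
Proof. by rewrite hat_sum; apply: eq_bigr => y yG; rewrite hlE ?sect_Gamma. Qed.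

Lemma hractE F a q :
  hract F a q = \sum_(y in Hh) rmon (F (q * (sect y)^-1)%g) (gcoef a y) (sect y).1.
Proof. by rewrite hat_sum; apply: eq_bigr => y yG; rewrite hrE ?sectHG ?sectH. Qed.

Lemma lmon0c g m : g \in G -> lmon 0 g m = 0.
Proof. by move=> gG; apply: (addIr (lmon 0 g m)); rewrite -lmonDl // !add0r. Qed.

Lemma rmon0c g m : g \in H -> rmon m 0 g = 0.
Proof. by move=> gG; apply: (addIr (rmon m 0 g)); rewrite -rmonDl // !add0r. Qed.

Lemma Gamma2 q : q \in Gamma -> q.2 \in Gh. Proof. by move/GammaP=> []. Qed.
Lemma Gamma1 q : q \in Gamma -> q.1 \in G. Proof. by move/GammaP=> []. Qed.

Lemma hat_subgroup x : is_subgroup (hat_comp_at x).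
Proof.
split=> [q qG _|F F' F0 F'0 q qG qx]; first exact: hat0.
by rewrite hatB F0 ?F'0 ?subrr.
Qed.

Lemma exists_hat_part (F : hat) x :
  exists F' : hat, forall q, F' q = if quo Gh Nh q.2 == x then F q else 0.
Proof.
pose F0 := [ffun q : gT * hT => if quo Gh Nh q.2 == x then F q else 0].
exists (insubd 0 F0) => q; rewrite hat_insubd ?ffunE // => {q}.
have [F1 _ _ _] := hatP F.
split=> [q qG|q qG|q n qG nN|q h qG hC]; rewrite !ffunE.
- by rewrite F1 ?if_same.
- case: eqP => _; first exact: hat_comp.
  by have [[+ _ _] _] := gM; case/(_ (quo G N q.1)).
- have nNh : iota n \in Nh by rewrite mem_morphim.
  have -> : quo Gh Nh (q * diag n)%g.2 = quo Gh Nh q.2.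
    rewrite -[(q * diag n)%g.2]/(q.2 * iota n)%g (quoM nsNhGh (Gamma2 qG)).
      have /eqP -> : quo Gh Nh (iota n) == 1%g by rewrite quo_eq1 ?(subsetP sNhGh).
      by rewrite mulg1.
    exact: (subsetP sNhGh).
  by rewrite hat_diag.
have -> : (q * cpair h)%g.2 = q.2 by rewrite -[LHS]/(q.2 * 1)%g mulg1.
by case: ifP => _; rewrite ?hat_cpair ?rmon0.
Qed.

Lemma hat_direct_sum : is_direct_sum hat_comp_at.
Proof.
split=> [x|F|f fc f0 x]; first exact: hat_subgroup.
  have [T TE] := choice (exists_hat_part F).
  exists T => [x q qG qx|]; first by rewrite TE (negPf qx).
  apply: hat_ext => q qG; rewrite hat_sum (bigD1 (quo Gh Nh q.2)) //= TE eqxx.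
  by rewrite big1 ?addr0 // => x xq; rewrite TE eq_sym (negPf xq).
apply: hat_ext => q qG; rewrite hat0; have [qx|/fc->//] := eqVneq (quo Gh Nh q.2) x.
have := congr1 (fun F : hat => F q) f0; rewrite /= hat_sum hat0 (bigD1 x) //=.
by rewrite big1 ?addr0 // => y yx; rewrite fc // qx eq_sym.
Qed.

Lemma hlact_comp (g x : subg_of (Gh / Nh)) (a : Ah) F :
  gring_comp g a -> hat_comp_at x F -> hat_comp_at (g * x)%g (hlact (balg_val a) F).
Proof.
move=> /gspanP ag Fx q qG qx; rewrite hlactE big1 // => y yG.
have yS := sect_Gamma yG; have [yg|yg] := boolP (y \in set_of_coset (sgval g)); last first.
  by rewrite ag // lmon0c // Gamma1.
rewrite Fx ?lmon0 ?groupM ?groupV //; apply: contra qx => /eqP <-.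
move: yg; rewrite (mem_coset_quo nsNhGh) => /andP[_ /eqP <-].
rewrite -[((sect y)^-1 * q)%g.2]/(y^-1 * q.2)%g -(quoM nsNhGh) ?mulKVg //.
by rewrite groupM ?groupV // Gamma2.
Qed.

Lemma hract_comp (x h : subg_of (Gh / Nh)) F (a : Ah') :
  hat_comp_at x F -> gring_comp h a -> hat_comp_at (x * h)%g (hract F (balg_val a)).
Proof.
move=> Fx /gspanP ah q qG qx; rewrite hractE big1 // => y yH.
have yS := sectHG yH; have yG := subsetP sHhGh y yH.
have [yh|yh] := boolP (y \in set_of_coset (sgval h)); last first.
  by rewrite ah // rmon0c // sectH.
rewrite Fx ?rmon0 ?groupM ?groupV //; apply: contra qx => /eqP <-.
move: yh; rewrite (mem_coset_quo nsNhGh) => /andP[_ /eqP <-].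
rewrite -[(q * (sect y)^-1)%g.2]/(q.2 * y^-1)%g -(quoM nsNhGh) ?mulgKV //.
by rewrite groupM ?groupV // Gamma2.
Qed.

Lemma hat_graded : graded_bimodule hat_bimod.
Proof.
split; first exact: hat_direct_sum.
by move=> g x h a F a' ag Fx ah; apply: hract_comp ah; apply: hlact_comp.
Qed.

Lemma cent2_Gamma y : y \in 'C_Gh(Nh)%g -> (1%g, y) \in Gamma.
Proof.
move=> /setIP[yG /centP yC]; apply/pullbackP; split=> //= n nN.
by rewrite conjg1 conjgE -yC ?mulKg // mem_morphim.
Qed.

Lemma cent2_Hh y : y \in 'C_Gh(Nh)%g -> y \in Hh.
Proof. by move=> /cent2_Gamma yG; rewrite (GammaH yG) group1. Qed.

(** An element y of C_Gh(Nh) lifts to (1, y), so it acts on either side by a mere translation of the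
    argument. The right translation by y and the left one by g y g^-1 agree on functions supported
    over g Nh. *)
Lemma hat_over_centralizer : bimodule_over_centralizer hat_bimod.
Proof.
move=> x g F a gx Fx aC; move: gx; rewrite (mem_coset_quo nsNhGh) => /andP[gG /eqP gx].
set C := 'C_Gh(Nh)%g in aC; have aH : gspan Hh a.
  by apply: gspanS aC; apply/subsetP => y; apply: cent2_Hh.
have gC : g \in 'N(C)%g.
  apply: (subsetP _ g gG).
  by rewrite normsI ?normG // (subset_trans (normal_norm nsNhGh)) // cent_norm.
have gaC := gconj_span gC aC.
have gaG : gspan Gh (gconj g a) by apply: gspanS gaC; apply: subsetIl.
have [bG _ _] := bhP; have [bH _ _] := bh'P.
rewrite /= (balg_ofE bh'P aH) (balg_ofE bhP gaG) hractA ?hract1; last first.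
  by apply: gspanS bH; apply: subsetIl.
rewrite hlactA ?hlact1; last by apply: gspanS bG; apply: subsetIl.
apply: hat_ext => q qG.
have sCH' : C \subset Hh by apply/subsetP => y; apply: cent2_Hh.
have sCG : C \subset Gh by apply: subsetIl.
transitivity (\sum_(y in C) lmon (gcoef a y) 1%g (F (q * (1%g, y)^-1)%g)).
  rewrite /hract hat_sum (big_setID C) /= [X in _ + X]big1 ?addr0; last first.
    move=> y /setDP[yH yC]; move/gspanP: aC => ->//.
    by rewrite hr0l ?hat0 ?sectHG ?sectH.
  rewrite (setIidPr sCH'); apply: eq_bigr => y yC.
  have yG := cent2_Gamma yC; have yH := subsetP sCH' y yC.
  rewrite -(hr_indep (gcoef a y) F yG (sectHG yH) erefl (group1 H)).
  rewrite (hrE F (gcoef a y) q yG (group1 H)).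
  have qyG : (q * (1%g, y)^-1)%g \in Gamma by rewrite groupM ?groupV.
  (* Used with the trivial element of C_G(N), to move the scalar from the right to the left. *)
  rewrite (rmon_cent _ (Gamma1 qyG) _ (hat_comp F qyG)) ?group1 //.
  by rewrite mulg1 mulgV.
rewrite /hlact [RHS]hat_sum [RHS](big_setID C) /= [X in _ = _ + X]big1 ?addr0; last first.
  move=> y /setDP[yG yC]; move/gspanP: gaC => ->//.
  by rewrite hl0l ?hat0 ?sect_Gamma.
(* The term of a at y is matched with that of its conjugate at g y g^-1. *)
rewrite (setIidPr sCG) [RHS](reindex_inj (conjg_inj g^-1%g)) /=.
apply: eq_big => [y|y yC]; first by rewrite memJ_norm // groupV.
have zC : (y ^ g^-1 \in C)%g by rewrite memJ_norm // groupV.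
have zG := cent2_Gamma zC; have zGh := subsetP sCG _ zC.
rewrite -(hl_indep _ F zG (sect_Gamma zGh) erefl) (hlE _ F q zG) gconjE conjgKV; congr (lmon _ _ _).
have yG := cent2_Gamma yC; have yGh := subsetP sCG _ yC; have q2G := Gamma2 qG.
have lG : (q * (1%g, y)^-1)%g \in Gamma by rewrite groupM ?groupV.
have rG : ((1%g, y ^ g^-1)^-1 * q)%g \in Gamma by rewrite groupM ?groupV.
have e2 : (((1%g, y ^ g^-1)^-1 * q)%g.2 = (g * y^-1 * (g^-1 * q.2))%g).
  by rewrite -[LHS]/((y ^ g^-1)^-1 * q.2)%g conjgE invgK !invMg invgK !mulgA.
(* In Nh, this element commutes with y and the two arguments of F coincide; otherwise both lie
   outside the support of F. *)
have [nN|nN] := boolP (g^-1 * (q.2 * y^-1) \in Nh)%g.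
  have /setIP[_ /centP yN] : y \in C by [].
  congr (hat_fun F _); apply: injective_projections.
    by rewrite -[LHS]/(q.1 * 1^-1)%g -[RHS]/(1^-1 * q.1)%g invg1 mulg1 mul1g.
  have uE : (g^-1 * q.2 = y * (g^-1 * (q.2 * y^-1)))%g.
    by rewrite (yN _ nN) !mulgA mulgKV.
  by rewrite e2 -[LHS]/(q.2 * y^-1)%g uE !mulgA mulgKV mulgV mul1g.
transitivity (0 : M).
  apply: Fx => //; apply: contra nN => /eqP; rewrite -gx => /eqP; rewrite eq_sym.
  by rewrite (quo_eq nsNhGh gG (Gamma2 lG)).
symmetry; apply: Fx => //; apply: contra nN => /eqP; rewrite -gx => /eqP; rewrite eq_sym.
rewrite (quo_eq nsNhGh gG (Gamma2 rG)) e2 !mulgA mulVg mul1g => nN.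
have /setIP[_ /centP yN] : y \in C by [].
have -> : (g^-1 * q.2 * y^-1 = y * (y^-1 * g^-1 * q.2) * y^-1)%g.
  by rewrite !mulgA mulgV mul1g.
by rewrite (yN _ nN) mulgK.
Qed.

(** * Moving elements, linear forms and endomorphisms from M to the new bimodule *)

Lemma hat_eq_fiber (F F' : hat) p q : p \in Gamma -> q \in Gamma -> F p = F' p ->
  (p^-1 * q)%g.2 \in Nh -> F q = F' q.
Proof.
move=> pG qG e tN; have tG : (p^-1 * q)%g \in Gamma by rewrite groupM ?groupV.
have [n [h [nN hC tE]]] := pullback_diag iota_inj tG tN sNhGh.
have -> : q = (p * diag n * cpair h)%g by rewrite -mulgA -tE mulKVg.
have pdG := groupM pG (diag_Gamma nN).
by rewrite (hat_cpair F pdG hC) (hat_cpair F' pdG hC) !hat_diag // e.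
Qed.

(** Recovers h from the product of [diag n] and [cpair h], hence a closed formula for functions
    supported on one coset. *)
Definition central_part (t : gT * hT) : gT := ((invm iota_inj t.2)^-1 * t.1)%g.

Lemma central_partE n h : n \in N -> central_part (diag n * cpair h)%g = h.
Proof.
move=> nN; rewrite /central_part -[(diag n * cpair h)%g.2]/(iota n * 1)%g mulg1 invmE //.
exact: mulKg.
Qed.

(** Over the coset p.2 Nh every pair is p (n, n)(h, 1), with h in C_G(N), and equivariance forces
    the value m h there. The result is consistent because n and h commute. *)
Lemma exists_delta p m : p \in Gamma -> gcomp (quo G N p.1) m ->
  exists D : hat, D p = m /\
    forall q, q \in Gamma -> (p^-1 * q)%g.2 \notin Nh -> D q = 0.
Proof.
move=> pG mp; have p1G := Gamma1 pG.
pose F0 : {ffun gT * hT -> M} := [ffun q => if (q \in Gamma) && ((p^-1 * q)%g.2 \in Nh)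
  then rmon m 1 (central_part (p^-1 * q)%g) else 0].
have F0E q n h : n \in N -> h \in 'C_G(N)%g -> q = (p * (diag n * cpair h))%g ->
    F0 q = rmon m 1 h.
  move=> nN hC ->; have dG := groupM (diag_Gamma nN) (cpair_Gamma hC).
  rewrite ffunE (groupM pG dG) mulKg central_partE //.
  by rewrite -[(diag n * cpair h)%g.2]/(iota n * 1)%g mulg1 mem_morphim.
have F00 q : (p^-1 * q)%g.2 \notin Nh -> F0 q = 0.
  by move=> qN; rewrite ffunE (negPf qN) andbF.
have dec q : q \in Gamma -> (p^-1 * q)%g.2 \in Nh -> exists n h,
    [/\ n \in N, h \in 'C_G(N)%g & q = (p * (diag n * cpair h))%g].
  move=> qG tN; have tG : (p^-1 * q)%g \in Gamma by rewrite groupM ?groupV.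
  have [n [h [nN hC tE]]] := pullback_diag iota_inj tG tN sNhGh.
  by exists n, h; rewrite -tE mulKVg.
have F0P : is_hat F0.
  split=> [q qG|q qG|q n qG nN|q h qG hC].
  - by rewrite ffunE (negPf qG).
  - have [tN|/F00->] := boolP ((p^-1 * q)%g.2 \in Nh); last first.
      by have [[+ _ _] _] := gM; case/(_ (quo G N q.1)).
    have [n [h [nN hC qE]]] := dec q qG tN; rewrite (F0E q n h) //.
    have hG : h \in G by case/setIP: hC.
    have -> : quo G N q.1 = (quo G N p.1 * quo G N h)%g.
      have nG := subsetP sNG n nN; rewrite qE -[(p * _)%g.1]/(p.1 * (n * h))%g.
      rewrite !(quoM nsNG) ?groupM //; have /eqP -> : quo G N n == 1%g by rewrite quo_eq1.
      by rewrite mul1g.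
    by apply: rmon_comp => //; apply: (subsetP sCH).
  - have [tN|tN] := boolP ((p^-1 * q)%g.2 \in Nh).
      have [k [h [kN hC qE]]] := dec q qG tN; rewrite (F0E q k h) //.
      apply: (F0E _ (k * n)%g) => //; first exact: groupM.
      rewrite qE diagM // -!mulgA; congr (_ * (_ * _))%g.
      have /setIP[_ /centP hN] := hC.
      by apply: injective_projections; rewrite /= ?mulg1 ?mul1g //; apply: hN.
    rewrite !F00 //; apply: contra tN; rewrite mulgA.
    rewrite -[(p^-1 * q * diag n)%g.2]/((p^-1 * q)%g.2 * iota n)%g groupMr //.
    by rewrite mem_morphim.
  have [tN|tN] := boolP ((p^-1 * q)%g.2 \in Nh).
    have [k [l [kN lC qE]]] := dec q qG tN; rewrite (F0E q k l) //.
    rewrite (rmonM m 1 1 (subsetP sCH _ lC) (subsetP sCH _ hC)) mulr1.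
    apply: (F0E _ k) => //; first exact: groupM.
    rewrite qE -!mulgA; congr (_ * (_ * _))%g.
    by apply: injective_projections; rewrite //= mulg1.
  rewrite !F00 ?rmon0 //; apply: contra tN; rewrite mulgA.
  by rewrite -[(p^-1 * q * cpair h)%g.2]/((p^-1 * q)%g.2 * 1)%g mulg1.
exists (insubd 0 F0); split=> [|q qG tN]; rewrite hat_insubd //; last exact: F00.
rewrite (F0E p 1%g 1%g) ?group1 ?rmon11 //.
have -> : (diag 1 * cpair 1 = 1)%g; last by rewrite mulg1.
by apply: injective_projections; rewrite /= ?morph1 mulg1.
Qed.

Lemma dual_lmon (f : mdual M) c g m : f (lmon c g m) = gmon G N G b c g * f m.
Proof. by rewrite lmonE dualZ. Qed.

(** Passing to (p.1 h, p.2) multiplies F p on the left by p.1 h p.1^-1, and f is left linear: the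
    coefficient moves from p.1 to p.1 h with its value unchanged. *)
Lemma gcoef_dual_indep (f : mdual M) (F : hat) p p' : p \in Gamma -> p' \in Gamma ->
  p.2 = p'.2 -> gcoef (balg_val (f (F p'))) p'.1 = gcoef (balg_val (f (F p))) p.1.
Proof.
move=> pG p'G e; have [h hC p'E] := pullback_fiber iota_inj pG p'G e.
have p1G := Gamma1 pG; have hG : h \in G by case/setIP: hC.
have p'1E : p'.1 = (p.1 * h)%g by rewrite p'E.
rewrite p'1E p'E (hat_cpair F pG hC) (rmon_cent 1 p1G hC (hat_comp F pG)) dual_lmon.
rewrite (gcoef_gmonMl bP) ?groupM ?groupV // mul1r; congr (gcoef _ _).
by rewrite !invMg invgK !mulgA mulgKV mulgKV.
Qed.

(** The form is built one coefficient at a time: the one at y is read off at any pair above y, by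
    [gcoef_dual_indep]. *)
Lemma exists_dual_hat (f : mdual M) : exists fh : mdual hat_bimod,
  forall (F : hat) p, p \in Gamma ->
    gcoef (balg_val (fh F)) p.2 = gcoef (balg_val (f (F p))) p.1.
Proof.
pose phi (F : hat) : galg R hT :=
  [ffun y => if y \in Gh then gcoef (balg_val (f (F (sect y)))) (sect y).1 else 0].
have phiE F y : gcoef (phi F) y =
    if y \in Gh then gcoef (balg_val (f (F (sect y)))) (sect y).1 else 0.
  by rewrite {1}/gcoef ffunE.
have phiG F : gspan Gh (phi F) by apply/gspanP => y yG; rewrite phiE (negPf yG).
have phiP F p : p \in Gamma -> gcoef (phi F) p.2 = gcoef (balg_val (f (F p))) p.1.
  move=> pG; rewrite phiE (Gamma2 pG); apply: gcoef_dual_indep => //.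
  exact: sect_Gamma (Gamma2 pG).
have phiD F F' : phi (F + F') = phi F + phi F'.
  apply/galgP => y; rewrite gaddE !phiE; case: ifP => _; last by rewrite addr0.
  by rewrite hatD dualD gaddE.
have phiM a F : gspan Gh a -> phi (hlact a F) = a * phi F.
  move=> aG; apply/galgP => w; have [wG|wG] := boolP (w \in Gh); last first.
    by rewrite phiE (negPf wG); symmetry; move/gspanP: (gspanM aG (phiG F)); apply.
  have wS := sect_Gamma wG.
  rewrite phiE wG hlactE dual_sum balg_val_sum gcoef_sum gcoefM big_mkcond.
  apply: eq_bigr => y _; case: ifPn => yG; last by move/gspanP: aG => -> //; rewrite mul0r.
  have yS := sect_Gamma yG; have tS : ((sect y)^-1 * sect w)%g \in Gamma by rewrite groupM ?groupV.
  rewrite dual_lmon (gcoef_gmonMl bP) ?(Gamma1 yS) //; congr (_ * _).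
  exact: (esym (phiP F _ tS)).
(* [balg_of] multiplies by [bh], which fixes phi F because phi is linear and [bh] fixes F. *)
have valE F : balg_val (balg_of Gh bh (phi F)) = phi F.
  rewrite (balg_ofE bhP (phiG F)) -phiM ?hlact1 //.
  by have [bG _ _] := bhP; apply: gspanS bG; apply: subsetIl.
have [|fh fhE] := @mk_dual _ _ _ hat_bimod (fun F => balg_of Gh bh (phi F)).
  split=> [F F'|a F]; first by rewrite phiD (balg_ofD bhP).
  have [aG _ _] := balg_valP bhP a.
  by rewrite -[in RHS](balg_of_val bhP a) -(balg_of_mul bhP) // -phiM.
by exists fh => F p pG; rewrite fhE valE phiP.
Qed.

Lemma sum_left_coset (V : nmodType) (T : hT -> V) w : w \in Gh ->
    (forall y, y \in Gh -> (w^-1 * y)%g \notin Nh -> T y = 0) ->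
  \sum_(y in Gh) T y = \sum_(n in N) T (w * iota n)%g.
Proof.
move=> wG T0; rewrite (reindex_inj (mulgI w)) /= (eq_bigl (mem Gh)) => [|y]; last first.
  by rewrite groupMl.
rewrite (big_setID Nh) /= [X in _ + X]big1 ?addr0 => [|y /setDP[yG yN]]; last first.
  by apply: T0; rewrite ?mulKg ?(groupM wG yG).
have NhE : Nh = iota @: N :> {set hT} by apply: morphimEdom.
rewrite (setIidPr sNhGh) NhE big_imset //=.
exact: (injmP iota_inj).
Qed.

Lemma sum_right_coset (V : nmodType) (T : hT -> V) w : w \in Hh ->
    (forall y, y \in Hh -> (y * w^-1)%g \notin Nh -> T y = 0) ->
  \sum_(y in Hh) T y = \sum_(n in H :&: N) T (iota n * w)%g.
Proof.
move=> wG T0; rewrite (reindex_inj (mulIg w)) /= (eq_bigl (mem Hh)) => [|y]; last first.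
  by rewrite groupMr.
rewrite (big_setID Nh) /= [X in _ + X]big1 ?addr0 => [|y /setDP[yG yN]]; last first.
  by apply: T0; rewrite ?mulgK ?(groupM yG wG).
have -> : Hh :&: Nh = iota @: (H :&: N).
  apply/setP => y; apply/setIP/imsetP => [[yH /morphimP[n nN _ yE]]|[n /setIP[nH nN] ->]].
    by exists n => //; rewrite inE nN andbT -(GammaH (diag_Gamma nN)) /= -yE.
  by rewrite (GammaH (diag_Gamma nN)) nH mem_morphim.
by rewrite big_imset //; apply: sub_in2 (injmP iota_inj) => n /setIP[].
Qed.

(** With w = q p^-1, the support of D leaves only the coefficients of fh F on w.2 Nh. They are those
    of f (F w) on w.1 N, and f (F w) has no others since f has degree 1. *)
Lemma hlact_dual_hat (f : mdual M) (fh : mdual hat_bimod) p (D F : hat) q :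
    (forall (F : hat) p, p \in Gamma ->
      gcoef (balg_val (fh F)) p.2 = gcoef (balg_val (f (F p))) p.1) ->
    dual_comp 1%g f -> p \in Gamma ->
    (forall q, q \in Gamma -> (p^-1 * q)%g.2 \notin Nh -> D q = 0) -> q \in Gamma ->
  hlact (balg_val (fh F)) D q = lact (f (F (q * p^-1)%g)) (D p).
Proof.
move=> fhE f1 pG D0 qG; have pVG : (p^-1)%g \in Gamma by rewrite groupV.
have [w wE] : exists w, w = (q * p^-1)%g by exists (q * p^-1)%g.
have wG : w \in Gamma by rewrite wE groupM.
rewrite -wE hlactE (sum_left_coset (w := w.2)) ?(Gamma2 wG) //; last first.
  move=> y yG yN; have tG : ((sect y)^-1 * q)%g \in Gamma.
    by rewrite groupM ?groupV ?sect_Gamma.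
  rewrite (D0 _ tG) ?lmon0 //; apply: contra yN.
  have -> : (p^-1 * ((sect y)^-1 * q))%g.2 = ((w.2^-1 * y)^-1 ^ p.2)%g.
    rewrite -[LHS]/(p.2^-1 * (y^-1 * q.2))%g wE -[(q * p^-1)%g.2]/(q.2 * p.2^-1)%g.
    by rewrite conjgE !invMg !invgK !mulgA mulgKV.
  by rewrite memJ_norm ?groupV // (subsetP (normal_norm nsNhGh)) ?Gamma2.
have fw : gring_comp (quo G N w.1) (f (F w)).
  by have := f1 _ _ (hat_comp F wG); rewrite mulg1.
rewrite [in RHS](gbalg_sum_lcoset nsNG (subxx G) bP sNG (Gamma1 wG) fw) lact_suml.
apply: eq_bigr => n nN; have dG := diag_Gamma nN; have tG := groupM wG dG.
have yG := Gamma2 tG; have yS := sect_Gamma yG.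
rewrite -[(w.2 * iota n)%g]/((w * diag n)%g.2).
rewrite (lmon_indep _ D tG yS erefl qG) (fhE F _ tG) (hat_diag F wG nN) lmonE.
congr (lact _ _); rewrite -(hat_diagl D pG (groupVr nN)); congr (hat_fun D _).
by rewrite diagV // invMg wE invMg invgK !mulgA mulgKV.
Qed.

(** Homogeneity gives a' = a0 p.1 with a0 supported in the intersection of H and N, a part shared by
    both groups; the lift is the image of a0 times p.2. *)
Lemma exists_lift p (a' : gbalg G N H b') : p \in Gamma -> p.1 \in H ->
  gring_comp (quo G N p.1) a' ->
  exists ah : Ah', forall (F : hat) q, q \in Gamma ->
    hract F (balg_val ah) q = ract (F (q * p^-1)%g) a'.
Proof.
move=> pG pH a'p; pose a0 := balg_val a' * gbase R p.1^-1%g.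
have pVG : (p^-1)%g \in Gamma by rewrite groupV.
have p2H : p.2 \in Hh by rewrite GammaH.
have [a'H ba' _] := balg_valP b'P a'.
have a0E g : gcoef a0 g = gcoef (balg_val a') (g * p.1)%g by rewrite gcoef_baseMr invgK.
have a0HN : gspan (H :&: N) a0.
  apply/gspanP => g gHN; rewrite a0E; move/gspanP: (gspan_comp b'P a'p); apply.
  apply: contra gHN; rewrite !inE (mem_coset_quo nsNG) groupMr // => /and3P[gH _ /eqP e].
  have gG := subsetP sHG g gH; have pG1 := Gamma1 pG.
  rewrite gH -(quo_eq1 nsNG gG); apply/eqP/(mulIg (quo G N p.1)).
  by rewrite -(quoM nsNG) // mul1g.
have a0N : gspan N a0 by apply: gspanS a0HN; apply: subsetIr.
have pa0H : gspan Hh (gpush N iota a0).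
  apply: gspanS (gpush_span iota_inj (subsetIr H N) a0HN).
  apply/subsetP => y /morphimP[n nN /setIP[nH _] ->].
  by rewrite (GammaH (diag_Gamma nN)).
have b'N : gspan N b' by have [bHN _ _] := b'P; apply: gspanS bHN; apply: subsetIr.
exists (balg_of Hh bh' (gpush N iota a0 * gbase R p.2)) => F q qG.
have -> : balg_val (balg_of Hh bh' (gpush N iota a0 * gbase R p.2)) =
          gpush N iota a0 * gbase R p.2.
  rewrite (balg_ofE bh'P); last by apply: gspanM => //; apply: gspan_base.
  by rewrite mulrA -(gpushM iota b'N a0N) /a0 mulrA ba'.
rewrite hractE (sum_right_coset (w := p.2)) //; last first.
  move=> y yH yN; rewrite gcoef_baseMr gpush_out ?rmon0c ?sectH //.
rewrite [in RHS](gbalg_sum_rcoset nsNG sHG b'P pH a'p) ract_sumr.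
apply: eq_bigr => n /setIP[nH nN]; have dG := diag_Gamma nN; have tG := groupM dG pG.
have yH : (iota n * p.2)%g \in Hh by rewrite groupM // (GammaH dG).
have tH : (diag n * p)%g.1 \in H by apply: (groupM nH pH).
rewrite gcoef_baseMr mulgK gpushE // a0E.
rewrite (rmon_indep _ F tG (sectHG yH) erefl tH qG) rmonE.
congr (ract _ _); rewrite -(hat_diag F (groupM qG pVG) (groupVr nN)); congr (hat_fun F _).
by rewrite diagV // invMg mulgA.
Qed.

(** For w in Hh, the part of a on the coset Nh w is carried to an element u of A' in the coset of
    p.1. Evaluating at p the product of a with the function concentrated over Nh with value m at 1
    gives m u, so u annihilates M_1. *)
Lemma hract_faithful (a : Ah') :
    (forall a' : gbalg G N H b', (forall m, ract m a' = 0) -> a' = 0) ->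
  (forall F : hat, hract F (balg_val a) = 0) -> a = 0.
Proof.
move=> faithM Fa; apply: val_inj; apply/galgP => w.
have [aH ba _] := balg_valP bh'P a; have [bHN _ _] := b'P.
have [wH|wH] := boolP (w \in Hh); last first.
  by rewrite [RHS]gzeroE; move/gspanP: aH; apply.
set p := sect w; have pG : p \in Gamma := sectHG wH; have pH : p.1 \in H := sectH wH.
pose u : gbalg G N H b' :=
  \sum_(n in H :&: N) gmon G N H b' (gcoef (balg_val a) (iota n * w)%g) (n * p.1)%g.
have u0 : u = 0.
  (* Degree 1 is enough, since an element of M_g is g applied to one of M_1. *)
  apply: faithM; suff u1 m : gcomp 1%g m -> ract m u = 0.
    move=> m; have [pr [_ prc prS _]] := direct_sum_proj gM.1.
    rewrite [m]prS ract_suml big1 // => x _; have [g gG gx] := quo_surj x.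
    rewrite -[pr x m](@lmon11 _) -(mulgV g) -[1]mulr1 -lmonM ?groupV // lmonE lractA.
    rewrite u1 ?lact0r //; have := lmon_comp 1 (groupVr gG) (prc x m).
    by rewrite -gx (quoV nsNG) // mulVg.
  move=> m1; have p1 : (1 : gT * hT)%g \in Gamma := group1 _.
  have [|D [D1 D0]] := @exists_delta 1%g m p1.
    by have := m1; rewrite -(quo1 nsNG).
  have := congr1 (fun F : hat => F p) (Fa D); rewrite hat0 hractE.
  rewrite (sum_right_coset (w := w)) //; last first.
    move=> y yH yN; have tG : (p * (sect y)^-1)%g \in Gamma by rewrite groupM ?groupV ?sectHG.
    rewrite (D0 _ tG) ?rmon0 //; apply: contra yN.
    by rewrite invg1 mul1g -[(p * _)%g.2]/(w * y^-1)%g -groupV invMg invgK.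
  move=> <-; rewrite ract_sumr; apply: eq_bigr => n /setIP[nH nN].
  have dG := diag_Gamma nN; have tG := groupM dG pG.
  have yH : (iota n * w)%g \in Hh by rewrite groupM // (GammaH dG).
  have tH : (diag n * p)%g.1 \in H by apply: (groupM nH pH).
  rewrite (rmon_indep _ D tG (sectHG yH) erefl tH pG) rmonE; congr (ract _ _).
  rewrite -D1 -(hat_diag D p1 (groupVr nN)); congr (hat_fun D _).
  by rewrite diagV // invMg mulgA mulgV.
have u0w := congr1 (fun a' : gbalg G N H b' => gcoef (balg_val a') p.1) u0.
(* The coefficient of u at p.1 is that of [bh'] a, which is a, at w. *)
rewrite [RHS]gzeroE; move: u0w; rewrite balg_val_sum gcoef_sum [X in _ = X -> _]gzeroE => <-.
have bhH : gspan Hh bh'.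
  by have [bH _ _] := bh'P; apply: gspanS bH; apply: subsetIl.
rewrite -[LHS]/(gcoef (balg_val a) w) -[in LHS]ba gcoefM.
transitivity (\sum_(z in Hh) gcoef bh' z * gcoef (balg_val a) (z^-1 * w)%g).
  rewrite [RHS]big_mkcond; apply: eq_bigr => z _; case: ifPn => // zH.
  by move/gspanP: bhH => -> //; rewrite mul0r.
rewrite (sum_gpush iota_inj (phi := fun c z => c * gcoef (balg_val a) (z^-1 * w)%g)
  (Y := H :&: N)) ?subsetIr //; first last.
- apply/subsetP => y /morphimP[n nN /setIP[nH _] ->].
  by rewrite (GammaH (diag_Gamma nN)).
- by move=> y _; rewrite mul0r.
rewrite (reindex_inj invg_inj) /=; apply: eq_big => [n|n nHN]; first by rewrite groupV.
have /setIP[nH nN] : n \in H :&: N by rewrite -groupV.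
rewrite (gcoef_gmon G b'P) ?(groupM nH pH) // morphV // invgK.
by congr (gcoef _ _ * _); rewrite invMg mulKVg.
Qed.

(** A lift of x to Gamma is moved into H by a diagonal element, which does not change the coset of
    its second coordinate. *)
Lemma exists_section x : (H * N)%g = G ->
  exists p, [/\ p \in Gamma, p.1 \in H & quo Gh Nh p.2 = x].
Proof.
move=> defG; have [y yGh <-] := quo_surj x; have [g gG] := Gamma_surj yGh.
have := Gamma1 gG; rewrite -{1}defG => /mulsgP[h n hH nN gE].
have dG := diag_Gamma (groupVr nN).
exists ((g, y) * diag n^-1)%g; split; first exact: groupM.
  by rewrite -[_.1]/(g * n^-1)%g; rewrite [g]gE mulgK.
have nNh : iota n^-1%g \in Nh by rewrite mem_morphim ?groupV.
rewrite -[_.2]/(y * iota n^-1)%g (quoM nsNhGh yGh (subsetP sNhGh _ nNh)).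
have /eqP -> : quo Gh Nh (iota n^-1%g) == 1%g by rewrite quo_eq1 ?(subsetP sNhGh).
by rewrite mulg1.
Qed.

(** The degree 1 generators and dual basis of M are placed over Nh and satisfy the same identities
    there. The dual basis writes any endomorphism as a sum of rank one operators, so only these must
    be realised by Ah'. *)
Lemma hat_morita_criterion : (H * N)%g = G -> morita_criterion M ->
  morita_criterion hat_bimod.
Proof.
move=> defG [[s1 s1E] [s2 s2E] endM faithM].
have gA := gbalg_graded nsNG (subxx G) bP; have gA' := gbalg_graded nsNG sHG b'P.
have unitsA' := gbalg_has_units nsNG sHG b'P defG.
have unitsA : has_units (gbalg G N G b).
  by apply: (gbalg_has_units nsNG (subxx G) bP); rewrite mulGSid.
have [I [m [f [mc fc mf1]]]] := degree1_generation gA A1 A'1 gM unitsA' s1E.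
have [J [n [g [nc gc ngE]]]] := degree1_dual_basis gA A1 A'1 gM unitsA s2E.
have p1 : (1 : gT * hT)%g \in Gamma := group1 _.
have delta1 k : gcomp 1%g k -> exists D : hat, D 1%g = k /\
    forall q, q \in Gamma -> ((1 : gT * hT)^-1 * q)%g.2 \notin Nh -> D q = 0.
  by move=> k1; apply: exists_delta => //; rewrite /= (quo1 nsNG).
have [dm dmP] := choice (fun i => delta1 _ (mc i)).
have [dn dnP] := choice (fun j => delta1 _ (nc j)).
have [fh fhE] := choice (fun i => exists_dual_hat (f i)).
have [gh ghE] := choice (fun j => exists_dual_hat (g j)).
have ghP j (F : hat) p (D : hat) q : p \in Gamma ->
    (forall q, q \in Gamma -> (p^-1 * q)%g.2 \notin Nh -> D q = 0) -> q \in Gamma ->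
    hlact (balg_val (gh j F)) D q = lact (g j (F (q * p^-1)%g)) (D p).
  by move=> pG D0 qG; apply: (hlact_dual_hat _ (ghE j)).
have basis (F : hat) : F = \sum_j hlact (balg_val (gh j F)) (dn j).
  apply: hat_ext => q qG; rewrite hat_sum [LHS]ngE; apply: eq_bigr => j _.
  by have [D1 D0] := dnP j; rewrite (ghP j F _ _ q p1 D0 qG) D1 invg1 mulg1.
split.
- exists [seq (dm i, fh i) | i <- enum I]; rewrite big_map big_enum /=.
  apply: val_inj; rewrite -[LHS]/(balg_val _) -[RHS]/(balg_val (1 : Ah)).
  apply/galgP => y; rewrite balg_val_sum gcoef_sum.
  have [bhN bhbh _] := bhP; have bhG : gspan Gh bh by apply: gspanS bhN; apply: subsetIl.
  have -> : balg_val (1 : Ah) = bh by apply: balg_unitE.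
  have [/morphimP[k kN _ ->]|yN] := boolP (y \in Nh).
    rewrite gpushE //; have kG := diag_Gamma kN.
    transitivity (gcoef (balg_val (\sum_i f i (m i))) k).
      rewrite balg_val_sum gcoef_sum; apply: eq_bigr => i _.
      have [D1 _] := dmP i; rewrite -[iota k]/((diag k).2) (fhE i _ _ kG).
      by rewrite -D1 -(hat_diag (dm i) p1 kN) mul1g.
    rewrite mf1; congr (gcoef _ _); apply: balg_unitE; last by have [] := bP.
    by have [bN _ _] := bP; apply: gspanS bN; apply: subsetIl.
  rewrite gpush_out // big1 // => i _; have [yG|yG] := boolP (y \in Gh).
    have yS := sect_Gamma yG; rewrite -[y]/((sect y).2) (fhE i _ _ yS).
    have [_ D0] := dmP i; rewrite D0 ?dual0 ?gzeroE //.
    by rewrite invg1 mul1g.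
  by have [/gspanP + _ _] := balg_valP bhP (fh i (dm i)); apply.
- exists [seq (dn j, gh j) | j <- enum J] => F; rewrite big_map big_enum /=.
  exact: basis.
- move=> u uD uL; have [kap kapP] := choice (fun x => exists_section x defG).
  have u0 : u 0 = 0 by apply: (addIr (u 0)); rewrite -uD !add0r.
  have homog j (K : hat) : exists a' : Ah', forall F : hat,
      hlact (balg_val (gh j F)) K = hract F (balg_val a').
    (* For the part of K over the coset x, the rank one operator z |-> g_j(z) K(kap x) of M is right
       multiplication by an element of A'; it is homogeneous, so it lifts to Ah'. *)
    have lifts x : exists a' : Ah', forall (F : hat) q, q \in Gamma ->
        hract F (balg_val a') q = lact (g j (F (q * (kap x)^-1)%g)) (K (kap x)).
      have [kG kH kx] := kapP x.
      have [z1 z2|a z|a' a'E] := endM (fun z => lact (g j z) (K (kap x))).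
      + by rewrite dualD lactDl.
      + by rewrite dualZ lactA.
      have a'k : gring_comp (quo G N (kap x).1) a'.
        apply: (ract_homogeneous gA' A1 gM faithM) => y z zy; rewrite -a'E.
        have gz : gring_comp y (g j z) by have := gc j _ _ zy; rewrite mulg1.
        exact: (lact_comp A'1 gM gz (hat_comp K kG)).
      have [ah ahE] := exists_lift kG kH a'k.
      by exists ah => F q qG; rewrite ahE // a'E.
    have [ah ahE] := choice lifts.
    have dK x : exists D : hat, D (kap x) = K (kap x) /\
        forall q, q \in Gamma -> ((kap x)^-1 * q)%g.2 \notin Nh -> D q = 0.
      by have [kG _ _] := kapP x; apply: exists_delta => //; apply: hat_comp.
    have [D DP] := choice dK.
    have fiber x q : q \in Gamma -> (((kap x)^-1 * q)%g.2 \in Nh) = (x == quo Gh Nh q.2).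
      move=> qG; have [kG _ kx] := kapP x.
      by rewrite -{2}kx (quo_eq nsNhGh (Gamma2 kG) (Gamma2 qG)).
    (* On each coset only one D x survives, and it agrees with K at the representative, hence on the
       whole fibre. *)
    have KE : K = \sum_x D x.
      apply: hat_ext => q qG; rewrite hat_sum (bigD1 (quo Gh Nh q.2)) //= big1 ?addr0.
        have [kG _ _] := kapP (quo Gh Nh q.2); have [DK _] := DP (quo Gh Nh q.2).
        by apply: (hat_eq_fiber kG qG (esym DK)); rewrite fiber.
      by move=> x xq; have [_ ->] := DP x; rewrite ?fiber.
    exists (\sum_x ah x) => F.
    transitivity (\sum_x hract F (balg_val (ah x))); last first.
      exact: (esym (@ract_sumr _ _ _ hat_bimod F _ _ _ ah)).
    rewrite KE; transitivity (\sum_x hlact (balg_val (gh j F)) (D x)).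
      exact: (@lact_sumr _ _ _ hat_bimod (gh j F)).
    apply: eq_bigr => x _.
    have [kG _ _] := kapP x; have [Dk D0] := DP x.
    by apply: hat_ext => q qG; rewrite ahE // -Dk; apply: ghP.
  have [ah ahE] := choice (fun j => homog j (u (dn j))).
  exists (\sum_j ah j) => F.
  transitivity (\sum_j hract F (balg_val (ah j))); last first.
    exact: (esym (@ract_sumr _ _ _ hat_bimod F _ _ _ ah)).
  rewrite {1}(basis F) (big_morph u uD u0); apply: eq_bigr => j _.
  by rewrite -ahE; apply: uL.
by move=> a aF; apply: hract_faithful.
Qed.

Lemma hat_induces_graded_morita : (H * N)%g = G -> morita_criterion M ->
  induces_graded_morita hat_bimod.
Proof.
move=> defG critM; have [] := criterion_graded_morita (gbalg_graded nsNhGh (subxx Gh) bhP)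
  (gbalg_graded nsNhGh sHhGh bh'P) (balg_comp1 nsNhGh (subxx Gh) bhP)
  (balg_comp1 nsNhGh sHhGh bh'P) hat_graded (hat_morita_criterion defG critM).
by split; [exact: hat_graded|exact: hat_over_centralizer| |].
Qed.

End Butterfly.

(** * The butterfly theorem *)

Section Automorphisms.
Variables (gT hT : finGroupType) (G N : {group gT}) (Gh : {group hT}).
Variables (iota : {morphism N >-> hT}) (iota_inj : ('injm iota)%g).
Hypotheses (nsNG : (N <| G)%g) (nsNhGh : (iota @* N <| Gh)%g).
Local Notation Nh := (iota @* N)%G.
Local Notation tau := (Aut_isom iota_inj (subxx N)).

(** Links Gamma to the conjugation maps of the theorem, so that conditions on images in Aut(N)
    become existence of pairs. *)
Lemma pullback_Aut g y : g \in G -> y \in Gh ->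
  ((g, y) \in pullback Gh iota nsNG) = (tau (conj_aut N g) == conj_aut Nh y).
Proof.
move=> gG yGh; have gN := subsetP (normal_norm nsNG) g gG.
have yN := subsetP (normal_norm nsNhGh) y yGh.
have aN : conj_aut N g \in Aut N by apply: Aut_aut.
have tauE n : n \in N -> tau (conj_aut N g) (iota n) = iota (n ^ g)%g.
  by move=> nN; rewrite Aut_isomE // norm_conj_autE.
apply/pullbackP/eqP => [[_ _ e]|e].
  apply: (@eq_Aut _ Nh); [exact: Aut_Aut_isom|exact: Aut_aut|].
  move=> _ /morphimP[n nN _ ->]; rewrite tauE // norm_conj_autE ?mem_morphim //.
  exact: e.
by split=> // n nN; rewrite -tauE // e norm_conj_autE ?mem_morphim.
Qed.

Lemma mem_Aut_conj (K : {group gT}) y : K \subset G -> y \in Gh ->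
  conj_aut Nh y \in (tau @* (conj_aut N @* K))%g ->
  exists2 g, g \in K & (g, y) \in pullback Gh iota nsNG.
Proof.
move=> sKG yGh /morphimP[a _ /morphimP[g _ gK ->] e]; exists g => //.
by rewrite pullback_Aut ?(subsetP sKG) // e eqxx.
Qed.

Lemma Aut_conj_mem (K : {group gT}) g y : K \subset G -> g \in K -> y \in Gh ->
  (g, y) \in pullback Gh iota nsNG -> conj_aut Nh y \in (tau @* (conj_aut N @* K))%g.
Proof.
move=> sKG gK yGh; have gG := subsetP sKG g gK; rewrite pullback_Aut // => /eqP <-.
have gN := subsetP (normal_norm nsNG) g gG.
by rewrite mem_morphim ?mem_morphim // Aut_aut.
Qed.
End Automorphisms.

Lemma gconj_gpush (R : comNzRingType) (gT hT : finGroupType) (G N : {group gT})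
    (Gh : {group hT}) (iota : {morphism N >-> hT}) (iota_inj : ('injm iota)%g)
    (nsNG : (N <| G)%g) (nsNhGh : (iota @* N <| Gh)%g) (a : galg R gT) g y :
  (g, y) \in pullback Gh iota nsNG ->
  gconj y (gpush N iota a) = gpush N iota (gconj g a).
Proof.
move=> /pullbackP[gG yGh gy]; apply/galgP => z; rewrite gconjE.
have yN := subsetP (normal_norm nsNhGh) y yGh.
have [/morphimP[n nN _ ->]|zN] := boolP (z \in (iota @* N)%g).
  by rewrite -gy // !gpushE // ?gconjE // (memN_conj nsNG).
by rewrite !gpush_out // memJ_norm.
Qed.

Theorem theorem3p9
  (p : nat) (O : idomainType) (k : closedFieldType) (red : {rmorphism O -> k})
  (O_cdvr : is_complete_dvr O)
  (k_res : is_residue_field red)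
  (k_char : p \in [pchar k])
  (gT : finGroupType) (G N G' : {group gT})
  (K_roots : has_roots_of_unity {fraction O} #|G|)
  (nsNG : (N <| G)%g)
  (sG'G : G' \subset G)
  (defG : (G' * N)%g = G)
  (b b' : galg O gT)
  (b_block : block_idempotent N b)
  (b'_block : block_idempotent (G' :&: N)%g b')
  (b_inv : ginvariant G b)
  (b'_inv : ginvariant G' b')
  (* N is a normal subgroup of Gh through the embedding iota *)
  (hT : finGroupType) (Gh : {group hT})
  (iota : {morphism N >-> hT})
  (iota_inj : ('injm iota)%g)
  (nsNGh : (iota @* N <| Gh)%g)
  (bh_inv : ginvariant Gh (gpush N iota b))
  (sCG' : ('C_G(N) \subset G')%g)
  (M : gbimod (gbalg G N G b) (gbalg G N G' b'))
  (M_morita : induces_graded_morita M)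
  (* Aut_isom identifies Aut N with Aut (iota N) *)
  (eps_eq : (Aut_isom iota_inj (subxx N) @* (conj_aut N @* G)
             = conj_aut (iota @* N) @* Gh)%g) :
  let Nh := (iota @* N)%G in
  let bh := gpush N iota b in
  let b'h := gpush N iota b' in
  let Gh' := (Gh :&: conj_aut Nh @*^-1
                (Aut_isom iota_inj (subxx N) @* (conj_aut N @* G')))%G in
  exists Mh : gbimod (gbalg Gh Nh Gh bh) (gbalg Gh Nh Gh' b'h),
    induces_graded_morita Mh.
Proof.
move=> Nh bh b'h Gh'.
have sNG := normal_sub nsNG; have sNhGh : Nh \subset Gh := normal_sub nsNGh.
have [[bN bb _] _ _] := b_block; have [[b'N b'b' _] _ _] := b'_block.
have b'N' : gspan N b' by apply: gspanS b'N; apply: subsetIr.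
have bP : invariant_idempotent N G b by split; rewrite // (setIidPr sNG).
have b'P : invariant_idempotent N G' b' by [].
have bhP : invariant_idempotent Nh Gh bh.
  split=> //; last by rewrite -gpushM // bb.
  by rewrite (setIidPr sNhGh); apply: gpush_span.
have sGh'Gh : Gh' \subset Gh := subsetIl _ _.
have Gamma_surj y : y \in Gh -> exists g, (g, y) \in pullback Gh iota nsNG.
  move=> yGh; have yN := subsetP (normal_norm nsNGh) y yGh.
  have [|g _ gy] := @mem_Aut_conj _ _ _ _ _ _ iota_inj nsNG nsNGh G y (subxx G) yGh.
    by rewrite eps_eq mem_morphim.
  by exists g.
(* If q.2 is in [Gh'], it is paired with some h in [G'], and q.1 differs from h by an element of
   C_G(N), hence of [G']. *)
have GammaH q : q \in pullback Gh iota nsNG -> (q.2 \in Gh') = (q.1 \in G').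
  move=> qG; have /pullbackP[q1G q2Gh _] := qG.
  have yN := subsetP (normal_norm nsNGh) q.2 q2Gh.
  rewrite inE q2Gh /=; apply/idP/idP => [/morphpreP[_]|q1G'].
    move=> /(mem_Aut_conj nsNG nsNGh sG'G q2Gh)[h hG' hy].
    have [c cC ->] := pullback_fiber iota_inj hy qG erefl.
    exact: groupM hG' (subsetP sCG' c cC).
  apply/morphpreP; split=> //; apply: (Aut_conj_mem iota_inj nsNGh sG'G q1G' q2Gh (nsNG := nsNG)).
  by rewrite -surjective_pairing.
have b'hP : invariant_idempotent Nh Gh' b'h.
  split; last 1 first.
  - move=> y yGh'; have [g gy] := Gamma_surj y (subsetP sGh'Gh y yGh').
    rewrite (gconj_gpush iota_inj nsNGh _ gy) b'_inv //.
    by rewrite -(GammaH _ gy).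
  - apply: gspanS (gpush_span iota_inj (subsetIr G' N) b'N).
    apply/subsetP => y /morphimP[n nN /setIP[nG' _] ->].
    by rewrite inE mem_morphim // andbT (GammaH _ (diag_pullback nsNG nN sNhGh)).
  by rewrite -gpushM // b'b'.
have [gM cM iso1 iso2] := M_morita.
by eexists; apply: (hat_induces_graded_morita sG'G sCG' iota_inj nsNGh sGh'Gh bP b'P bhP b'hP
  Gamma_surj GammaH gM cM defG (iso_morita_criterion iso1 iso2)).
Qed.
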